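(* For every set $E\subseteq[3]^4$ of (distinct) clauses, $L_E=R_E$.
   Context: $[3]=\{1,2,3\}$. A clause $e\in E\subseteq[3]^4$ is a tuple $(q_e^{(1)},\dots,q_e^{(4)})$; coordinate $\alpha$ is the question of player $\alpha$. The incidence matrix $A$ has rows indexed by $E$ and columns by pairs $(\alpha,j)$, $1\le\alpha\le4$, $j\in[3]$, with $A_{e,(\alpha,j)}=1$ if $q_e^{(\alpha)}=j$ and $0$ otherwise. Put $K_E=\ker_{\mathbb Z}(A^{\mathsf T})\subseteq\mathbb Z^E$ and $L_E=\{y\bmod2:y\in K_E\}\subseteq\mathbb F_2^E$. A clause word $w=e_1\cdots e_N$ is a finite sequence of elements of $E$. It is balanced if for each player $\alpha$ the projected word $q_{e_1}^{(\alpha)}\cdots q_{e_N}^{(\alpha)}$, viewed as a word in involutive letters (one generator of order two per question, no other relations), freely reduces to the identity, i.e. can be reduced to the empty word by repeatedly deleting adjacent equal letters. The vector $\pi(w)\in\mathbb F_2^E$ records the parity of the number of occurrences of each clause in $w$, and $R_E=\operatorname{span}_{\mathbb F_2}\{\pi(w):w\text{ balanced}\}$. *)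

(* Defs.v *)
From mathcomp Require Import all_boot all_order all_algebra.
From mathcomp Require Import classical_sets.

Local Open Scope classical_set_scope.
Local Open Scope ring_scope.

(* [tnth e a] is the question of player [a] in the clause [e]; the three
   questions 1, 2, 3 are encoded as 0, 1, 2 in ['I_3]. *)
Notation clause := (4.-tuple 'I_3).

(* Vectors indexed by [E] are column vectors of height [#|E|], and columns
   indexed by pairs (player, question) have indices in ['I_#|{: 'I_4 * 'I_3}|];
   both index types are decoded with [enum_val]. *)
Definition incidence (E : {set clause}) :
    'M[int]_(#|E|, #|{: 'I_4 * 'I_3}|) :=
  \matrix_(i, k)
    (tnth (enum_val i) (enum_val k).1 == (enum_val k).2)%:R.

Definition K_ (E : {set clause}) : set 'cV[int]_#|E| :=
  [set y | (incidence E)^T *m y = 0].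

Definition L_ (E : {set clause}) : set 'cV['F_2]_#|E| :=
  [set map_mx (fun z : int => z%:~R) y | y in K_ E].

Inductive cancels {T : Type} : seq T -> Prop :=
| cancels_nil : cancels [::]
| cancels_pair (u v : seq T) (x : T) :
    cancels (u ++ v) -> cancels (u ++ [:: x, x & v]).

Definition clause_word (E : {set clause}) (w : seq clause) : Prop :=
  {subset w <= E}.

Definition balanced (w : seq clause) : Prop :=
  forall a : 'I_4, cancels [seq tnth e a | e <- w].

Definition parity (E : {set clause}) (w : seq clause) : 'cV['F_2]_#|E| :=
  \col_i (count_mem (enum_val i) w)%:R.

(* [<<s>>%VS] only spans finite lists; for an arbitrary set take the union of
   the spans of the lists drawn from it. *)
Definition lin_span {F : fieldType} {V : vectType F} (X : set V) : set V :=
  [set v | exists2 s : seq V, {in s, forall u, X u} & v \in <<s>>%VS].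

Definition R_ (E : {set clause}) : set 'cV['F_2]_#|E| :=
  lin_span [set parity E w | w in [set w | clause_word E w /\ balanced w]].

(* Main.v *)
Require Import Defs.
From mathcomp Require Import all_boot all_order all_algebra.
From mathcomp Require Import classical_sets.
From HB Require Import structures.
From mathcomp Require boolp.
From mathcomp Require Import fingroup perm ring zify.
From Stdlib Require Import Setoid Morphisms.

(** Signing the letters of a balanced word alternately gives an integer kernel
    vector, because cancelled letters are adjacent; so [R_E] is contained in
    [L_E]. Conversely, a kernel vector is the signed count of some even clause
    word [w], each of whose four projections lies in the commutator subgroup of
    the even part [F] (free of rank two) of the free product of three groups of
    order two. Clause words with zero signed counts do not change parities, and
    multiplying [w] by such words one kills its projections one player after
    the other.

    If a player misses a question, or its question is a function of that of
    another player, then three players have to be killed. The commutator of a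
    word trivial for player [i] and a word trivial for player [k] is trivial for
    both, and such commutators reach all of [F'] at the third player unless one
    bit of the question is shared by the three players. In that exceptional case
    [w] splits along the bit into two words in which the three players use at
    most two questions, so that these players are killed at once.

    Otherwise the commutators reach [F'] at a player with two others trivial, and
    [[F', F]] with all three others trivial. What remains is an area vector in
    [Z^4], modulo the area vectors of commutators. If some triple of clauses is
    rainbow (has three distinct questions) for an odd number of players, these
    vectors generate a subgroup of odd index, and an odd power of [w] can be
    killed. If all triples are rainbow for an even number of players, a finite
    search shows that [E], after deleting at most two clauses on which all kernel
    vectors vanish, is in one of the previous cases. *)

Set Implicit Arguments.
Unset Strict Implicit.
Unset Printing Implicit Defensive.

Import GRing.Theory.
Local Open Scope ring_scope.

(** * The free product of groups of order two as a group of reduced words *)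

Section Reduction.
Variable T : choiceType.
Implicit Types (x : T) (s u v : seq T).

Definition push x s :=
  if s is y :: s' then if x == y then s' else x :: s else [:: x].

Definition red u := foldr push [::] u.

Definition reduced s := sorted (fun x y => x != y) s.

Lemma reduced_push x s : reduced s -> reduced (push x s).
Proof.
case: s => [|y s] //= h; case: eqVneq => [_|xy].
  exact: path_sorted h.
by rewrite /= xy.
Qed.

Lemma reduced_red u : reduced (red u).
Proof. by elim: u => //= x u; apply: reduced_push. Qed.

Lemma red_id s : reduced s -> red s = s.
Proof.
elim: s => //= x s IH h; rewrite IH; last exact: path_sorted h.
by case: s h {IH} => //= y s /andP[/negbTE ->].
Qed.

Lemma pushK x s : reduced s -> push x (push x s) = s.
Proof.
case: s => [|y s] //= h; first by rewrite eqxx.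
case: eqVneq h => [->|xy] h; last by rewrite /= eqxx.
by case: s h => [|t s] //= /andP[/negbTE ->].
Qed.

Lemma reduced_foldr s u : reduced s -> reduced (foldr push s u).
Proof. by move=> hs; elim: u => //= x u; apply: reduced_push. Qed.

Lemma foldr_push s x t :
  reduced s -> foldr push s (push x t) = push x (foldr push s t).
Proof.
move=> hs; case: t => [|y t] //=; case: eqVneq => //= <-.
by rewrite pushK // reduced_foldr.
Qed.

(** Each letter acts on reduced words through [push] as an involution, so a word and its reduction
    act alike; associativity of the group law comes from this. *)
Lemma foldr_red s u : reduced s -> foldr push s (red u) = foldr push s u.
Proof. by move=> hs; elim: u => //= x u IH; rewrite foldr_push // IH. Qed.

Lemma red_cat u v : red (u ++ v) = foldr push (red v) u.
Proof. by rewrite /red foldr_cat. Qed.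

Lemma red_catl u v : red (red u ++ v) = red (u ++ v).
Proof. by rewrite !red_cat foldr_red // reduced_red. Qed.

Lemma red_catr u v : red (u ++ red v) = red (u ++ v).
Proof. by rewrite !red_cat (red_id (reduced_red v)). Qed.

Lemma red_pair u x v : red (u ++ x :: x :: v) = red (u ++ v).
Proof. by rewrite !red_cat /= pushK // reduced_red. Qed.

Lemma red_revl u : red (rev u ++ u) = [::].
Proof.
by elim: u => // x u IH; rewrite rev_cons cat_rcons red_pair.
Qed.

Lemma not_reduced u :
  ~~ reduced u -> exists a x b, u = a ++ x :: x :: b.
Proof.
elim: u => //= x u IH; case: u IH => //= y u IH.
rewrite negb_and negbK => /orP[/eqP->|/IH[a [t [b ->]]]].
  by exists [::], y, u.
by exists (x :: a), t, b.
Qed.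

Lemma cancelsE u : cancels u <-> red u = [::].
Proof.
split=> [|].
  by elim=> // {}u v x _; rewrite red_pair.
elim: {u}_.+1 {-2}u (ltnSn (size u)) => // n IH u hn hu.
case: (boolP (reduced u)) => [/red_id|/not_reduced[a [x [b eu]]]].
  by rewrite hu => <-; apply: cancels_nil.
move: hu hn; rewrite eu red_pair => hu hn.
apply/cancels_pair/IH => //; move: hn; rewrite !size_cat /=; lia.
Qed.

Record invol := Invol { invol_val :> seq T; _ : reduced invol_val }.
HB.instance Definition _ := [isSub for invol_val].
HB.instance Definition _ := [Choice of invol by <:].

Definition wd u : invol := Invol (reduced_red u).

Lemma wd_val (g : invol) : wd (val g) = g.
Proof. by apply: val_inj => /=; apply/red_id/(valP g). Qed.

Definition invol_mul (g h : invol) := wd (val g ++ val h).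
Definition invol_inv (g : invol) := wd (rev (val g)).

Fact invol_mulA : associative invol_mul.
Proof.
move=> f g h; apply: val_inj; rewrite /= red_catr red_catl.
by rewrite catA.
Qed.

Fact invol_mul1 : left_id (wd [::]) invol_mul.
Proof. by move=> g; apply: val_inj => /=; apply/red_id/(valP g). Qed.

Fact invol_mulr1 : right_id (wd [::]) invol_mul.
Proof.
by move=> g; apply: val_inj => /=; rewrite cats0; apply/red_id/(valP g).
Qed.

Fact invol_mulV : left_inverse (wd [::]) invol_inv invol_mul.
Proof. by move=> g; apply: val_inj; rewrite /= red_catl red_revl. Qed.

Fact invol_mulrV : right_inverse (wd [::]) invol_inv invol_mul.
Proof.
move=> g; apply: val_inj; rewrite /= red_catr -{1}[val g]revK.
exact: red_revl.
Qed.

HB.instance Definition _ :=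
  isGroup.Build invol invol_mulA invol_mul1 invol_mulr1 invol_mulV invol_mulrV.

Lemma wd_cat u v : wd (u ++ v) = (wd u * wd v)%g.
Proof. by apply: val_inj; rewrite /= red_catl red_catr. Qed.

Lemma wd_cons x u : wd (x :: u) = (wd [:: x] * wd u)%g.
Proof. by rewrite -wd_cat. Qed.

Lemma wd_rev u : wd (rev u) = (wd u)^-1%g.
Proof.
apply: (mulIg (wd u)); rewrite mulVg -wd_cat.
by apply: val_inj; rewrite /= red_revl.
Qed.

Lemma wd_gg x : (wd [:: x] * wd [:: x])%g = 1%g.
Proof. by apply: val_inj; rewrite /= eqxx. Qed.

Lemma wd1P u : wd u = 1%g <-> cancels u.
Proof.
rewrite cancelsE; split=> [/(congr1 val)//|h].
by apply: val_inj; rewrite /= h.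
Qed.

End Reduction.

Notation "'x_ p" := (wd [:: p]) (at level 8, p at level 2, format "''x_' p").

(** * Collection in a class two quotient *)

Lemma int_stepind (P : int -> Prop) :
  P 0 -> (forall m, P m -> P (m + 1)) -> (forall m, P m -> P (m - 1)) ->
  forall m, P m.
Proof.
move=> P0 PS PP; elim/int_rec => // n IH.
  by rewrite -addn1 PoszD; apply: PS.
by rewrite -addn1 PoszD opprD; apply: PP.
Qed.

Section IntegerPowers.
Variable G : groupType.
Implicit Types (g h t : G) (m n : int).

Definition expz g m : G := match m with Posz n => g ^+ n | Negz n => g ^- n.+1 end%g.

Lemma expz0 g : expz g 0 = 1%g. Proof. by []. Qed.

Lemma expz1 g : expz g 1 = g. Proof. by []. Qed.

Lemma expzS g m : expz g (m + 1) = (expz g m * g)%g.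
Proof.
case: m => n; first by rewrite -PoszD addn1 /= expgSr.
case: n => [|n]; first by rewrite /= expg1 mulVg.
have -> : Negz n.+1 + 1 = Negz n by lia.
by rewrite /= [(g ^+ n.+2)%g]expgS invgM mulgVK.
Qed.

Lemma expzP g m : expz g (m - 1) = (expz g m * g^-1)%g.
Proof. by rewrite -{2}[m](subrK 1) expzS mulgK. Qed.

Lemma expz_comm g m : (g * expz g m = expz g m * g)%g.
Proof.
by case: m => n; [|apply: commuteV]; apply/commuteX/commute_refl.
Qed.

Lemma expz_commV g m : (g^-1 * expz g m = expz g m * g^-1)%g.
Proof. by apply: (mulgI g); rewrite mulVKg mulgA expz_comm mulgK. Qed.

Lemma expzD g m n : expz g (m + n) = (expz g m * expz g n)%g.
Proof.
elim/int_stepind: n => [|n IH|n IH]; first by rewrite addr0 expz0 mulg1.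
  by rewrite addrA !expzS IH mulgA.
by rewrite addrA !expzP IH mulgA.
Qed.

Lemma expzN g m : expz g (- m) = (expz g m)^-1%g.
Proof. by apply: (mulIg (expz g m)); rewrite mulVg -expzD addNr. Qed.

End IntegerPowers.

Section NormalPredicate.
Variables (G : groupType) (D : G -> Prop).

(** Normal subgroups are given as predicates because the free product is infinite. *)
Record normal_pred : Prop := NormalPred {
  np1 : D 1%g;
  npM : forall g h, D g -> D h -> D (g * h)%g;
  npV : forall g, D g -> D g^-1%g;
  npJ : forall g h, D g -> D (g ^ h)%g }.

Hypothesis nD : normal_pred.

Definition eqmod (g h : G) : Prop := D (g^-1 * h)%g.

Lemma eqmod_refl g : eqmod g g.
Proof. by rewrite /eqmod mulVg; apply: np1. Qed.

Lemma eqmod_sym g h : eqmod g h -> eqmod h g.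
Proof. by move/(npV nD); rewrite invgM invgK. Qed.

Lemma eqmod_trans g h t : eqmod g h -> eqmod h t -> eqmod g t.
Proof. by move=> a b; have := npM nD a b; rewrite -mulgA mulVKg. Qed.

Lemma eqmodMl t g h : eqmod g h -> eqmod (t * g)%g (t * h)%g.
Proof. by rewrite /eqmod invgM -mulgA mulKg. Qed.

Lemma eqmodMr t g h : eqmod g h -> eqmod (g * t)%g (h * t)%g.
Proof. by move/(npJ nD t); rewrite /eqmod conjgE invgM !mulgA. Qed.

Lemma eqmod1 g : eqmod 1%g g <-> D g.
Proof. by rewrite /eqmod invg1 mul1g. Qed.

Lemma eqmod_commg g h : D [~ g, h]%g <-> eqmod (h * g)%g (g * h)%g.
Proof. by rewrite /eqmod commgEl conjgE invgM !mulgA. Qed.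

Lemma eqmod_mulV g h :
  eqmod (h * g)%g (g * h)%g -> eqmod (h * g^-1)%g (g^-1 * h)%g.
Proof.
move=> gh; have := eqmodMl g^-1 (eqmodMr g^-1 gh).
by rewrite !mulgA mulVg mul1g mulgK => /eqmod_sym.
Qed.

Lemma commg_expz g h m : D [~ g, h]%g -> eqmod (expz h m * g)%g (g * expz h m)%g.
Proof.
move/eqmod_commg => gh; elim/int_stepind: m => [|m IH|m IH].
- by rewrite expz0 mul1g mulg1; apply: eqmod_refl.
- rewrite expzS -mulgA; apply: (eqmod_trans (eqmodMl _ gh)).
  by rewrite !mulgA; apply: eqmodMr.
rewrite expzP -mulgA.
have gh' := eqmod_sym (eqmod_mulV (eqmod_sym gh)).
by apply: (eqmod_trans (eqmodMl _ gh')); rewrite !mulgA; apply: eqmodMr.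
Qed.

#[local] Instance eqmod_equiv : Equivalence eqmod.
Proof.
split; [exact: eqmod_refl | exact: eqmod_sym | exact: eqmod_trans].
Qed.

#[local] Instance eqmod_mul :
  Proper (eqmod ==> eqmod ==> eqmod) (fun g h => g * h)%g.
Proof.
by move=> g g' hg h h' hh; apply/(eqmod_trans (eqmodMr _ hg))/eqmodMl.
Qed.

Section Heisenberg.
Variables a b z : G.
Hypothesis ab : (a * b = b * a * z)%g.
Hypotheses (za : D [~ z, a]%g) (zb : D [~ z, b]%g).

Lemma expzC c n : D [~ z, c]%g -> eqmod (expz z n * c)%g (c * expz z n)%g.
Proof. by move=> h; apply: commg_expz; rewrite -invgR; apply: (npV nD). Qed.

(** Each of the [n] factors [b] that [a] crosses leaves one [z], which is central modulo [D], as in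
    the Heisenberg group. *)
Lemma heisenberg_mull (n : int) :
  eqmod (a * expz b n)%g (expz b n * a * expz z n)%g.
Proof.
have zb' m := expzC m zb; have zbV m := eqmod_mulV (zb' m).
have abV : eqmod (a * b^-1)%g (b^-1 * a * z^-1)%g.
  have e : eqmod a (b * a * b^-1 * z)%g.
    have := zbV 1; rewrite /= expg1 => zbV1.
    by rewrite -mulgA -zbV1 mulgA -ab mulgK; apply: eqmod_refl.
  by rewrite {2}e !mulgA mulVg mul1g mulgK; apply: eqmod_refl.
elim/int_stepind: n => [|n IH|n IH].
- by rewrite !expz0 mul1g !mulg1; apply: eqmod_refl.
- rewrite !expzS mulgA IH -[(_ * a * _ * b)%g]mulgA zb' !mulgA.
  rewrite -[(_ * a * b)%g]mulgA ab !mulgA -[(_ * z * _)%g]mulgA expz_comm.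
  by rewrite !mulgA; apply: eqmod_refl.
rewrite !expzP mulgA IH -[(_ * a * _ * _)%g]mulgA zbV !mulgA.
rewrite -[(_ * a * b^-1)%g]mulgA abV !mulgA -[(_ * z^-1 * _)%g]mulgA expz_commV.
by rewrite !mulgA; apply: eqmod_refl.
Qed.

Lemma heisenberg_mulVl (n : int) :
  eqmod (a^-1 * expz b n)%g (expz b n * a^-1 * expz z (- n))%g.
Proof.
have zaV m := eqmod_mulV (expzC m za).
have := eqmodMl a^-1 (eqmodMr (a^-1 * expz z (- n)) (heisenberg_mull n)).
rewrite !mulgA mulVg mul1g => ->.
rewrite -!mulgA [(expz z n * (_ * _))%g]mulgA zaV.
by rewrite expzN mulgK mulgV mulg1; apply: eqmod_refl.
Qed.

Lemma expz_expzC m n : eqmod (expz z m * expz a n)%g (expz a n * expz z m)%g.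
Proof.
apply: eqmod_sym; apply: commg_expz; apply/eqmod_commg.
by apply: eqmod_sym; apply: expzC.
Qed.

Lemma heisenberg_Ml m n k :
  eqmod (a * (expz b n * expz a m * expz z k))%g
        (expz b n * expz a (m + 1) * expz z (k + n))%g.
Proof.
rewrite !mulgA heisenberg_mull -[(_ * expz z n * _)%g]mulgA expz_expzC.
rewrite [m + 1]addrC [k + n]addrC !expzD expz1 !mulgA.
exact: eqmod_refl.
Qed.

Lemma heisenberg_MVl m n k :
  eqmod (a^-1 * (expz b n * expz a m * expz z k))%g
        (expz b n * expz a (m - 1) * expz z (k - n))%g.
Proof.
rewrite !mulgA heisenberg_mulVl -[(_ * expz z (- n) * _)%g]mulgA expz_expzC.
rewrite [m - 1]addrC [k - n]addrC !expzD !expzN expz1 !mulgA.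
exact: eqmod_refl.
Qed.

End Heisenberg.
End NormalPredicate.

(** * Signed letter counts and areas of words *)

Section SignedCounts.
Variable T : eqType.
Implicit Types (x q r : T) (u v : seq T).

(* The letters of [u] are counted with alternating signs, the first one
   positively; [area] counts pairs [q], [r] in this order, with the product of
   their signs. Both are invariant under cancellation. *)
Fixpoint scount q u : int := if u is x :: v then (x == q)%:R - scount q v else 0.

Lemma scount_cat q u v :
  scount q (u ++ v) = scount q u + (-1) ^+ size u * scount q v.
Proof.
elim: u => [|x u IH] /=; first by rewrite add0r mul1r.
by rewrite IH exprS; ring.
Qed.

Lemma scount_cat0 q u v : ~~ odd (size u) ->
  scount q (u ++ v) = scount q u + scount q v.
Proof. by move=> hu; rewrite scount_cat -signr_odd (negbTE hu) mul1r. Qed.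

Lemma scount_rev q u : scount q (rev u) = (-1) ^+ (size u).+1 * scount q u.
Proof.
elim: u => [|x u IH]; first by rewrite mulr0.
rewrite rev_cons -cats1 scount_cat IH size_rev /= !exprS.
by have := sqrr_sign int (size u); rewrite expr2 => e; ring.
Qed.

Lemma scount_rev0 q u : ~~ odd (size u) -> scount q (rev u) = - scount q u.
Proof. by move=> hu; rewrite scount_rev exprS -signr_odd (negbTE hu) mulr1 mulN1r. Qed.

Fixpoint area q r u : int :=
  if u is x :: v then area q r v - (x == q)%:R * scount r v else 0.

Lemma area_cat q r u v :
  area q r (u ++ v) =
  area q r u + area q r v + (-1) ^+ size u * scount q u * scount r v.
Proof.
elim: u => [|x u IH] /=; first by rewrite add0r mulr0 mul0r addr0.
by rewrite IH exprS scount_cat; ring.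
Qed.

Lemma scount_cancels q u : cancels u -> scount q u = 0.
Proof.
elim=> // {}u v x _; rewrite !scount_cat /= => <-; ring.
Qed.

(** Adjacent equal letters have opposite signs, so their contributions with any other letter cancel;
    the pair formed by these two letters would count only for [q = r]. *)
Lemma area_cancels q r u : q != r -> cancels u -> area q r u = 0.
Proof.
move=> qr; elim=> // {}u v x _; rewrite !area_cat /= => <-.
case: (eqVneq x q) => [->|_]; last by rewrite /= !mul0r !subr0; ring.
by rewrite (negbTE qr) /=; ring.
Qed.

End SignedCounts.

(** * Collecting words in involutive letters *)

Section FreeInvolutions.
Variable T : choiceType.
Implicit Types (p q r : T) (u : seq T).
Local Notation W := (invol T).

Lemma wd_size u : wd u = 1%g -> ~~ odd (size u).
Proof.
by move/wd1P; elim=> // {}u v x _; rewrite !size_cat /= !oddD /= negbK.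
Qed.

(* Every swap of [b] and [a] while collecting [u] leaves a central factor [z]. *)
Lemma collection (D : W -> Prop) p q r u : normal_pred D -> uniq [:: p; q; r] ->
  let a := ('x_p * 'x_q)%g in let b := ('x_p * 'x_r)%g in let z := [~ a, b]%g in
  D [~ z, a]%g -> D [~ z, b]%g -> {subset u <= [:: p; q; r]} ->
  eqmod D (wd u)
   ((if odd (size u) then 'x_p else 1) *
    expz b (- (-1) ^+ size u * scount r u) * expz a (- (-1) ^+ size u * scount q u) *
    expz z (area q r u))%g.
Proof.
move=> nD + a b z za zb.
rewrite /= !inE negb_or andbT => /andP[/andP[pq pr] qr].
have ab : (a * b = b * a * z)%g by rewrite -commgC.
have xp2 : ('x_p * 'x_p = 1)%g := wd_gg p.
have aV : (a^-1 = 'x_q * 'x_p)%g by rewrite invgM -!wd_rev.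
have bV : (b^-1 = 'x_r * 'x_p)%g by rewrite invgM -!wd_rev.
have xq : ('x_q = 'x_p * a)%g by rewrite /a mulgA xp2 mul1g.
have xr : ('x_r = 'x_p * b)%g by rewrite /b mulgA xp2 mul1g.
elim: u => [|x u IH] hu; first by rewrite /= ?mulr0 ?expz0 ?mulg1; apply: eqmod_refl.
have {}IH := IH (fun y hy => hu y (mem_behead (s := x :: u) hy)).
have := hu x (mem_head _ _); rewrite !inE.
have Eq := @eqmod_equiv _ _ nD; have Mu := @eqmod_mul _ _ nD.
rewrite wd_cons IH [size _]/= exprS mulN1r opprK /= -signr_odd.
clearbody z b a.
set n := scount r u; set m := scount q u; set k := area q r u.
have cE (g h : W) : g = h -> eqmod D g h by move=> ->; apply: eqmod_refl.
(* Six cases: the new first letter, and the parity of the rest. Before an odd rest, ['x_q] and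
   ['x_r] meet ['x_p] and give [a^-1] and [b^-1]; before an even one they are written ['x_p * a] and
   ['x_p * b]. *)
case/or3P=> /eqP ->; rewrite ?eqxx ?(negbTE pq) ?(negbTE pr) ?(negbTE qr)
  1?[r == q]eq_sym ?(negbTE qr); case: (odd _); rewrite /= ?expr0 ?expr1.
- apply: cE; rewrite !mulgA xp2 !mul1g; congr (expz b _ * expz a _ * expz z _)%g; ring.
- apply: cE; rewrite !mulgA mulg1; congr (_ * expz b _ * expz a _ * expz z _)%g; ring.
- rewrite -!mulgA [('x_q * _)%g]mulgA -aV ![(expz b _ * _)%g]mulgA.
  rewrite (heisenberg_MVl nD ab za zb) mul1g; apply: cE.
  rewrite !mulgA; congr (expz b _ * expz a _ * expz z _)%g; ring.
- rewrite mul1g xq -mulgA (heisenberg_Ml nD ab za zb) !mulgA; apply: cE.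
  congr (_ * expz b _ * expz a _ * expz z _)%g; ring.
- apply: cE; rewrite -!mulgA [('x_r * _)%g]mulgA -bV mulgA.
  have -> : (b^-1 = expz b (-1))%g by [].
  rewrite -expzD mul1g !mulgA; congr (expz b _ * expz a _ * expz z _)%g; ring.
apply: cE; rewrite mul1g xr !mulgA -[('x_p * b * _)%g]mulgA.
have -> : (b * expz b (- (1) * n) = expz b (1 - n))%g.
  by rewrite expzD mulN1r expz1.
congr (_ * expz b _ * expz a _ * expz z _)%g; ring.
Qed.

Lemma collection0 (D : W -> Prop) p q r u : normal_pred D -> uniq [:: p; q; r] ->
  let a := ('x_p * 'x_q)%g in let b := ('x_p * 'x_r)%g in let z := [~ a, b]%g in
  D [~ z, a]%g -> D [~ z, b]%g -> {subset u <= [:: p; q; r]} ->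
  ~~ odd (size u) -> (forall t, scount t u = 0) ->
  eqmod D (wd u) (expz z (area q r u)).
Proof.
move=> nD pqr a b z za zb hu /negbTE ou s0.
have := collection nD pqr za zb hu.
by rewrite !s0 ou /= !mulr0 !expz0 !mul1g.
Qed.

(** Collection turns such a word into a power of the commutator of the two generators, so a normal
    subgroup containing this one commutator contains them all. *)
Lemma commutator_collection (D : W -> Prop) p q r u :
  normal_pred D -> uniq [:: p; q; r] ->
  D [~ 'x_p * 'x_q, 'x_p * 'x_r]%g -> {subset u <= [:: p; q; r]} ->
  ~~ odd (size u) -> (forall t, scount t u = 0) -> D (wd u).
Proof.
move=> nD pqr Dz hu ou s0.
have DzJ c : D [~ [~ 'x_p * 'x_q, 'x_p * 'x_r], c]%g.
  by rewrite commgEl; apply: (npM nD); [apply: (npV nD)|apply: (npJ nD)].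
have /(eqmod_sym nD) := collection0 nD pqr (DzJ _) (DzJ _) hu ou s0.
rewrite /eqmod => h.
have DE m : D (expz [~ 'x_p * 'x_q, 'x_p * 'x_r]%g m).
  elim/int_stepind: m => [|m IH|m IH]; first exact: (np1 nD).
    by rewrite expzS; apply: (npM nD).
  by rewrite expzP; apply: (npM nD) => //; apply: (npV nD).
by have := npM nD (DE (area q r u)) h; rewrite mulVKg.
Qed.

(** A reduced word in two letters alternates between them, so each letter always carries the same
    sign. *)
Lemma reduced_scount p q x u : reduced (x :: u) -> {subset x :: u <= [:: p; q]} ->
  1 <= scount x (x :: u) /\
  forall t, t \in [:: p; q] -> t != x -> scount t (x :: u) <= 0.
Proof.
elim: u x => [|y u IH] x.
  by move=> _ _ /=; rewrite eqxx; split=> // t _; rewrite eq_sym => /negbTE ->.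
move=> /= /andP[xy ru] hu.
have [h1 h2] := IH y ru (fun t ht => hu t (mem_behead (s := x :: y :: u) ht)).
have [hx hy] : x \in [:: p; q] /\ y \in [:: p; q].
  by split; apply: hu; rewrite !inE eqxx ?orbT.
split; first by have := h2 x hx xy; rewrite eqxx /=; lia.
move=> t ht tx; rewrite eq_sym (negbTE tx) /=.
have -> : t = y.
  move: ht hx hy tx xy; rewrite !inE.
  by do 3![case/orP=> /eqP ->]; rewrite ?eqxx.
by rewrite /= in h1; lia.
Qed.

(** On two letters the even part is infinite cyclic, so its commutator subgroup is trivial. *)
Lemma two_letters p q u :
  {subset u <= [:: p; q]} -> (forall t, scount t u = 0) -> cancels u.
Proof.
elim: {u}_.+1 {-2}u (ltnSn (size u)) => // n IH u hn hu s0.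
case: (boolP (reduced u)) => [ru|/not_reduced[a [x [b eu]]]].
  case: u hn ru hu s0 => [|x u] _ ru hu s0; first exact: cancels_nil.
  by have [] := reduced_scount ru hu; rewrite s0.
rewrite eu; apply/cancels_pair/IH.
- by move: hn; rewrite eu !size_cat /=; lia.
- move=> y hy; apply: hu; move: hy; rewrite eu !(mem_cat, inE).
  by case/orP=> ->; rewrite ?orbT.
- by move=> t; rewrite -(s0 t) eu !scount_cat /=; ring.
Qed.
End FreeInvolutions.

(** * Clause words *)

Lemma ord3_full (p q r x : 'I_3) : uniq [:: p; q; r] -> x \in [:: p; q; r].
Proof.
move=> u; have c : #|[:: p; q; r]| = #|'I_3| by rewrite (card_uniqP u) card_ord.
by have /(subset_cardP c) -> : [:: p; q; r] \subset 'I_3 by apply/fintype.subsetP.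
Qed.

Lemma ord3_third (p q : 'I_3) : p != q -> exists r, uniq [:: p; q; r].
Proof.
move=> pq; have /card_gt0P[r] : (0 < #|~: [set p; q]|)%N.
  by rewrite cardsCs finset.setCK cards2 pq card_ord.
rewrite !inE negb_or => /andP[rp rq]; exists r.
by rewrite /= !inE negb_or pq ![_ == r]eq_sym rp rq.
Qed.

Lemma ord3_others (t : 'I_3) : exists p q, uniq [:: p; q; t].
Proof.
have /card_gt0P[p] : (0 < #|~: [set t]|)%N by rewrite cardsC1 card_ord.
rewrite !inE => pt; have [q] := ord3_third pt.
rewrite /= !inE !negb_or !andbT => /andP[/andP[_ pq] tq].
by exists p, q; rewrite /= !inE !negb_or pq pt eq_sym tq.
Qed.

Lemma ord4_fresh (s : seq 'I_4) : (size s < 4)%N -> exists x, x \notin s.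
Proof.
move=> hs; have /card_gt0P[x hx] : (0 < #|[predC (mem s)]|)%N.
  have := cardC (mem s); rewrite card_ord.
  have cs : (#|mem s| <= size s)%N := card_size s.
  by case: #|[predC _]| => //; rewrite addn0 => e; move: cs; rewrite e leqNgt hs.
by exists x.
Qed.

Lemma ord4_others (i l : 'I_4) : i != l -> exists j k, uniq [:: l; k; j; i].
Proof.
move=> il; have [j hj] := @ord4_fresh [:: i; l] isT.
have [k hk] := @ord4_fresh [:: j; i; l] isT.
exists j, k; move: hj hk; rewrite /= !inE !negb_or.
case/andP=> ji jl /and3P[kj ki kl].
by rewrite ![l == _]eq_sym kl jl il kj ki ji.
Qed.

Lemma ord4_full (s : seq 'I_4) a : uniq s -> size s = 4%N -> a \in s.
Proof.
move=> us ss; have c : #|s| = #|'I_4| by rewrite (card_uniqP us) ss card_ord.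
by have /(subset_cardP c) -> : s \subset 'I_4 by apply/fintype.subsetP.
Qed.

Definition proj (a : 'I_4) (w : seq clause) : seq 'I_3 := [seq tnth e a | e <- w].
Definition ev (a : 'I_4) (w : seq clause) : invol 'I_3 := wd (proj a w).

Lemma proj_cat a v w : proj a (v ++ w) = proj a v ++ proj a w.
Proof. exact: map_cat. Qed.

Lemma ev_cat a v w : ev a (v ++ w) = (ev a v * ev a w)%g.
Proof. by rewrite /ev proj_cat wd_cat. Qed.

Lemma ev_rev a w : ev a (rev w) = (ev a w)^-1%g.
Proof. by rewrite /ev /proj map_rev wd_rev. Qed.

Lemma ev_pair a e f : ev a [:: e; f] = ('x_(tnth e a) * 'x_(tnth f a))%g.
Proof. by rewrite -wd_cat. Qed.

Lemma scount_proj a q w :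
  scount q (proj a w) = \sum_(e : clause | tnth e a == q) scount e w.
Proof.
elim: w => [|x w IH] /=; first by rewrite big1.
rewrite IH big_split /= sumrN; congr (_ - _).
rewrite big_mkcond (bigD1 x) //= eqxx big1 ?addr0; first by case: eqP.
by move=> e /negbTE; rewrite eq_sym => ->; case: ifP.
Qed.

Lemma scount_odd (T : eqType) (e : T) w : odd `|scount e w|%N = odd (count_mem e w).
Proof.
elim: w => //= x w IH; rewrite oddD -IH oddb.
by case: (x == e); lia.
Qed.

Section Words.
Variable E : {set clause}.
Implicit Types (S : seq 'I_4) (i j k l : 'I_4) (p q r : 'I_3) (u v w n : seq clause).

(* Null words represent commutators of even clause words, while the projections
   of admissible words are products of commutators of even words in the
   questions. *)
Definition null n :=
  [/\ {subset n <= E}, ~~ odd (size n) & forall e : clause, scount e n = 0].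

Definition admissible w :=
  [/\ {subset w <= E}, ~~ odd (size w) & forall a q, scount q (proj a w) = 0].

(** Applied to words made from kernel vectors, this gives [L_E] inside [R_E] in a strong form: a
    single balanced word, without taking a span. *)
Definition solvable_set := forall w, admissible w ->
  exists v, [/\ {subset v <= E}, balanced v &
    forall e, odd (count_mem e v) = odd (count_mem e w)].

Lemma null_admissible n : null n -> admissible n.
Proof.
by case=> nE on n0; split=> // a q; rewrite scount_proj big1.
Qed.

Lemma null_count n (e : clause) : null n -> odd (count_mem e n) = false.
Proof. by case=> _ _ n0; rewrite -scount_odd n0. Qed.

Lemma sub_cat u v : {subset u <= E} -> {subset v <= E} -> {subset u ++ v <= E}.
Proof. by move=> hu hv e; rewrite mem_cat => /orP[/hu|/hv]. Qed.

Lemma sub_rev u : {subset u <= E} -> {subset rev u <= E}.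
Proof. by move=> hu e; rewrite mem_rev => /hu. Qed.

Lemma sub_pair (e f : clause) : e \in E -> f \in E -> {subset [:: e; f] <= E}.
Proof. by move=> he hf g; rewrite !inE => /orP[] /eqP ->. Qed.

Lemma null_nil : null [::]. Proof. by split. Qed.

Lemma null_cat u v : null u -> null v -> null (u ++ v).
Proof.
move=> [uE ou u0] [vE ov v0]; split; first exact: sub_cat.
  by rewrite size_cat oddD (negbTE ou) (negbTE ov).
by move=> e; rewrite scount_cat0 // u0 v0.
Qed.

Lemma null_rev u : null u -> null (rev u).
Proof.
move=> [uE ou u0]; split; first exact: sub_rev.
  by rewrite size_rev.
by move=> e; rewrite scount_rev u0 mulr0.
Qed.

(** [u] may have odd length: as [n] is even, a letter of [u] and its mirror image in [rev u] carry
    opposite signs. *)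
Lemma null_conj u n : {subset u <= E} -> null n -> null (rev u ++ n ++ u).
Proof.
move=> uE [nE on n0]; split; first by do !apply: sub_cat => //; apply: sub_rev.
  by rewrite !size_cat size_rev !oddD (negbTE on); case: odd.
move=> e; rewrite scount_cat (scount_cat0 _ _ on) n0 scount_rev size_rev exprS.
by ring.
Qed.

Lemma null_comm u v : {subset u <= E} -> {subset v <= E} ->
  ~~ odd (size u) -> ~~ odd (size v) -> null (rev u ++ rev v ++ u ++ v).
Proof.
move=> uE vE ou ov; split; first by do !apply: sub_cat => //; apply: sub_rev.
  by rewrite !size_cat !size_rev !oddD (negbTE ou) (negbTE ov).
move=> e; rewrite !scount_cat0 ?size_rev // !scount_rev0 //; ring.
Qed.

Lemma admissible_cat u n : admissible u -> null n -> admissible (u ++ n).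
Proof.
move=> [uE ou u0] /null_admissible[nE on n0]; split; first exact: sub_cat.
  by rewrite size_cat oddD (negbTE ou) (negbTE on).
by move=> a q; rewrite proj_cat scount_cat0 ?size_map // u0 n0.
Qed.

(** * Commutators trivial for given players, and the killing of projections *)

Definition uses_all l := forall q, exists2 e : clause, e \in E & tnth e l = q.

Lemma uses_all_lift l g : uses_all l -> exists2 w, {subset w <= E} & ev l w = g.
Proof.
move=> ul; rewrite -(wd_val g); elim: (val g) => [|q s [w wE ew]].
  by exists [::].
have [e eE eq] := ul q; exists (e :: w).
  by move=> f; rewrite inE => /orP[/eqP->|/wE].
by rewrite wd_cons -ew -eq -wd_cat.
Qed.

(* Elements obtained at player [l] by null words that are trivial for [S]. *)
Definition reach S l (g : invol 'I_3) :=
  exists n, [/\ null n, {in S, forall s, ev s n = 1%g} & ev l n = g].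

(** If [l] is asked every question, each conjugator lifts to a clause word, and conjugating by it
    preserves nullity and triviality for [S]. *)
Lemma reach_normal S l : uses_all l -> normal_pred (reach S l).
Proof.
move=> ul; split.
- by exists [::]; split=> //; apply: null_nil.
- move=> _ _ [m [m0 mS <-]] [n [n0 nS <-]]; exists (m ++ n); split.
  + exact: null_cat.
  + by move=> s sS; rewrite ev_cat mS ?nS ?mulg1.
  + by rewrite ev_cat.
- move=> _ [m [m0 mS <-]]; exists (rev m); split; first exact: null_rev.
  + by move=> s sS; rewrite ev_rev mS ?invg1.
  + by rewrite ev_rev.
move=> _ h [m [m0 mS <-]]; have [u uE <-] := uses_all_lift h ul.
exists (rev u ++ m ++ u); split; first exact: null_conj.
  by move=> s sS; rewrite !ev_cat ev_rev mS // mul1g mulVg.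
by rewrite !ev_cat ev_rev conjgE.
Qed.

Lemma reach_comm S l u v : {subset u <= E} -> {subset v <= E} ->
  ~~ odd (size u) -> ~~ odd (size v) ->
  {in S, forall s, [~ ev s u, ev s v]%g = 1%g} ->
  reach S l [~ ev l u, ev l v]%g.
Proof.
move=> uE vE ou ov hS; exists (rev u ++ rev v ++ u ++ v); split.
- exact: null_comm.
- by move=> s sS; rewrite !ev_cat !ev_rev -(hS s sS) commgEl conjgE !mulgA.
by rewrite !ev_cat !ev_rev commgEl conjgE !mulgA.
Qed.

(** One step of the elimination: once the players of [S] are trivial, a null word makes [l] trivial
    too without disturbing them. *)
Definition kills S l := forall w,
  admissible w -> {in S, forall s, ev s w = 1%g} -> reach S l (ev l w).

Lemma kills_trivial S l :
  (forall w, admissible w -> {in S, forall s, ev s w = 1%g} -> ev l w = 1%g) ->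
  kills S l.
Proof. by move=> h w /h{}h /h ->; exists [::]; split=> //; apply: null_nil. Qed.

Lemma missing_letter l t w : (forall e, e \in w -> tnth e l != t) ->
  (forall q, scount q (proj l w) = 0) -> ev l w = 1%g.
Proof.
move=> ht w0; apply/wd1P; have [p [q pqt]] := ord3_others t.
apply: (@two_letters _ p q) => // _ /mapP[e /ht et ->].
by have := ord3_full (tnth e l) pqt; rewrite !inE (negbTE et) orbF.
Qed.

Lemma kills_commutator S l p q r : uses_all l -> uniq [:: p; q; r] ->
  reach S l [~ 'x_p * 'x_q, 'x_p * 'x_r]%g -> kills S l.
Proof.
move=> ul pqr hz w [wE ow w0] _.
apply: (commutator_collection (reach_normal S ul) pqr hz).
- by move=> x _; apply: ord3_full.
- by rewrite size_map.
- exact: w0.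
Qed.

Definition conn i l p q := exists2 w, {subset w <= E} &
  ev i w = 1%g /\ ev l w = ('x_p * 'x_q)%g.

Definition determines i l := {in E &, forall e f : clause,
  tnth e i = tnth f i -> tnth e l = tnth f l}.

Lemma conn_clauses i l (e f : clause) : e \in E -> f \in E ->
  tnth e i = tnth f i -> conn i l (tnth e l) (tnth f l).
Proof.
move=> eE fE ef; exists [:: e; f]; first exact: sub_pair.
by rewrite !ev_pair ef wd_gg.
Qed.

Lemma conn_sym i l p q : conn i l p q -> conn i l q p.
Proof.
case=> w wE [wi wl]; exists (rev w); first exact: sub_rev.
by rewrite !ev_rev wi wl invg1 -!wd_cat -wd_rev.
Qed.

(** The projection at [l] is a letterwise image of the projection at [i], and cancellations survive
    such a map. *)
Lemma determines_ev i l w : determines i l -> {subset w <= E} ->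
  ev i w = 1%g -> ev l w = 1%g.
Proof.
move=> d wE /wd1P c; apply/wd1P.
(* [phi] is the map from questions of [i] to questions of [l]; the default [p] concerns only
   questions that no clause of [E] asks. *)
pose phi p := odflt p (omap (fun e : clause => tnth e l) [pick e in E | tnth e i == p]).
have -> : proj l w = map phi (proj i w).
  rewrite -map_comp; apply/eq_in_map => e /wE eE /=; rewrite /phi.
  case: pickP => [f /andP[fE /eqP fi]|/(_ e)]; last by rewrite eE eqxx.
  exact: d.
elim: c => [|u v x _ IH]; first exact: cancels_nil.
by rewrite map_cat /=; apply: cancels_pair; rewrite -map_cat.
Qed.

Lemma not_determines i l : ~ determines i l -> exists p q, p != q /\ conn i l p q.
Proof.
move=> nd; have [/forall_inP h|] := boolP [forall e in E, forall f in E,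
   (tnth e i == tnth f i) ==> (tnth e l == tnth f l)].
  case: nd => e f eE fE /eqP ef; apply/eqP.
  by move/forall_inP: (h e eE) => /(_ f fE)/implyP; apply.
rewrite negb_forall => /existsP[e]; rewrite negb_imply => /andP[eE].
rewrite negb_forall => /existsP[f]; rewrite negb_imply => /andP[fE].
rewrite negb_imply => /andP[/eqP ef nl].
by exists (tnth e l), (tnth f l); split=> //; apply: conn_clauses.
Qed.

Lemma uses_allPn l : uses_all l \/ exists t, {in E, forall e : clause, tnth e l != t}.
Proof.
have [/forallP h|] := boolP [forall q, exists e in E, tnth e l == q].
  by left=> q; have /exists_inP[e eE /eqP] := h q; exists e.
rewrite negb_forall => /existsP[t]; rewrite negb_exists_in => /forall_inP h.
by right; exists t.
Qed.

Lemma kills_missing S l t : {in E, forall e : clause, tnth e l != t} -> kills S l.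
Proof.
move=> ht; apply: kills_trivial => w [wE _ w0] _.
by apply: (missing_letter (t := t)) => // e /wE /ht.
Qed.

Lemma kills0 l : kills [::] l.
Proof.
have [ul|[t]] := uses_allPn l; last exact: kills_missing.
have u3 : uniq [:: ord0; 1; 2 : 'I_3] by [].
apply: (kills_commutator ul u3).
have [e0 E0 <-] := ul ord0; have [e2 E2 <-] := ul 2; have [e1 E1 <-] := ul 1.
by rewrite -!ev_pair; apply: reach_comm => //; apply: sub_pair.
Qed.

Lemma kills_determined S i l : i \in S -> determines i l -> kills S l.
Proof.
move=> iS d; apply: kills_trivial => w [wE _ _] wS.
exact: (determines_ev d wE (wS i iS)).
Qed.

Lemma determines_dec i l : determines i l \/ ~ determines i l.
Proof.
have [/forall_inP h|h] := boolP [forall e in E, forall f in E,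
   (tnth e i == tnth f i) ==> (tnth e l == tnth f l)]; [left|right].
  move=> e f eE fE /eqP ef; apply/eqP.
  by move/forall_inP: (h e eE) => /(_ f fE)/implyP; apply.
move=> d; move/negP: h; apply; apply/forall_inP => e eE; apply/forall_inP => f fE.
by apply/implyP => /eqP ef; apply/eqP/d.
Qed.

Lemma conn_even i l p q : conn i l p q -> exists w, [/\ {subset w <= E}, ~~ odd (size w),
  ev i w = 1%g & ev l w = ('x_p * 'x_q)%g].
Proof.
case=> w wE [wi wl]; exists w; split=> //.
by have := wd_size wi; rewrite size_map.
Qed.

(** If [i] does not determine [l], two clauses agreeing at [i] and differing at [l] form a word
    trivial for [i]; so is its commutator with any even word. *)
Lemma kills1 i l : kills [:: i] l.
Proof.
have [ul|[t]] := uses_allPn l; last exact: kills_missing.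
have [d|/not_determines[p [q [pq /conn_even[w [wE ow wi wl]]]]]] := determines_dec i l.
  by apply: kills_determined d; rewrite mem_head.
have [r pqr] := ord3_third pq; apply: (kills_commutator ul pqr).
have [e eE ep] := ul p; have [f fE fr] := ul r.
have -> : ('x_p * 'x_r)%g = ev l [:: e; f] by rewrite ev_pair ep fr.
rewrite -wl; apply: reach_comm => //; first exact: sub_pair.
by move=> s; rewrite inE => /eqP ->; rewrite wi comm1g.
Qed.

Definition determines_bit i k l r := {in E &, forall e f : clause,
  tnth e i = tnth f i \/ tnth e k = tnth f k -> (tnth e l == r) = (tnth f l == r)}.

Definition shared_bit i k l r := uses_all l /\ determines_bit i k l r.

(** Connections are edges on the three questions, and two distinct edges of a triangle share a
    vertex, which becomes the new [p]. *)
Lemma conn_join i k l p q p' q' : p != q -> p' != q' ->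
  ~~ ((p' \in [:: p; q]) && (q' \in [:: p; q])) ->
  conn i l p q -> conn k l p' q' ->
  exists p q r, [/\ uniq [:: p; q; r], conn i l p q & conn k l p r].
Proof.
move=> pq pq' h ci ck; move: h; rewrite /= !inE.
have U s t t' : s != t -> t' != s -> t' != t -> uniq [:: s; t; t'].
  by move=> a b c; rewrite /= !inE negb_or a ![_ == t']eq_sym b c.
case: (eqVneq p' p) => [e|pp] /=.
  rewrite e in ck pq'; rewrite [q' == p]eq_sym (negbTE pq') /= => qq.
  by exists p, q, q'; split=> //; apply: U; rewrite // eq_sym.
case: (eqVneq p' q) => [e|pq'' ] /=.
  rewrite e in ck pq'; rewrite [q' == q]eq_sym (negbTE pq') orbF => qq.
  by exists q, p, q'; split; [apply: U; rewrite // eq_sym|apply: conn_sym|].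
move=> _; have [r pqr] := ord3_third pq.
have hr x : x != p -> x != q -> x = r.
  by have := ord3_full x pqr; rewrite !inE => /or3P[] /eqP-> //; rewrite eqxx.
case: (eqVneq q' p) => [e|qp].
  by exists p, q, p'; split; [apply: U|..|rewrite -e; apply: conn_sym].
case: (eqVneq q' q) => [e|qq]; last by move: pq'; rewrite (hr _ pp pq'') (hr _ qp qq) eqxx.
exists q, p, p'; split; [by apply: U => //; rewrite eq_sym|exact: conn_sym|].
by rewrite -e; apply: conn_sym.
Qed.

(** If [i] and [k] connect only along the same edge, the third question [r] is isolated, and whether
    [l] is asked [r] is a bit known to both. *)
Lemma conn_pair i k l : uses_all l -> ~ determines i l -> ~ determines k l ->
  (exists r, shared_bit i k l r) \/
  exists p q r, [/\ uniq [:: p; q; r], conn i l p q & conn k l p r].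
Proof.
move=> ul /not_determines[p [q [pq ci]]] /not_determines[p' [q' [pq' ck]]].
have [h|h] := boolP ((p' \in [:: p; q]) && (q' \in [:: p; q])); last first.
  by right; apply: conn_join pq pq' h ci ck.
have [r pqr] := ord3_third pq.
have rE x : x \in [:: p; q] = (x != r).
  have := ord3_full x pqr; move: pqr; rewrite /= !inE !negb_or !andbT.
  case/andP=> /andP[_ pr] qr.
  by case/or3P=> /eqP->; rewrite ?eqxx ?pr ?qr ?orbT // ![r == _]eq_sym (negbTE pr) (negbTE qr).
have [/forall_inP sb|] := boolP [forall e in E, forall f in E,
   ((tnth e i == tnth f i) || (tnth e k == tnth f k)) ==>
   ((tnth e l == r) == (tnth f l == r))].
  left; exists r; split=> // e f eE fE ef.
  move/forall_inP: (sb e eE) => /(_ f fE)/implyP h'; apply: (elimT eqP); apply: h'.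
  by case: ef => ->; rewrite eqxx ?orbT.
rewrite negb_forall => /existsP[e]; rewrite negb_imply => /andP[eE].
rewrite negb_forall => /existsP[f]; rewrite negb_imply => /andP[fE].
rewrite negb_imply => /andP[ef nl]; right.
have ne : tnth e l != tnth f l by apply: contraNneq nl => ->.
have nr : ~~ ((tnth e l \in [:: p; q]) && (tnth f l \in [:: p; q])).
  by move: nl; rewrite !rE; do 2!case: (_ == r).
(* The clauses [e] and [f] give one of the players a second edge, which ends in [r]; it is joined
   with the old edge of the other player. *)
case/orP: ef => /eqP ef; last first.
  exact: conn_join pq ne nr ci (conn_clauses l eE fE ef).
have pq0 := pq'; apply: conn_join ne pq' _ (conn_clauses l eE fE ef) ck.
apply: contra nr => /andP[]; have := h; rewrite !inE => h' hp hq; move: h'.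
case/orP: hp pq0 => /eqP->; case/orP: hq => /eqP->; rewrite ?eqxx //= => _.
by rewrite andbC.
Qed.

(** The commutator of a word trivial for [i] and a word trivial for [k] is trivial for both;
    [conn_pair] supplies two with suitable values at [l]. *)
Lemma kills2 i k l : (forall r, ~ shared_bit i k l r) -> kills [:: i; k] l.
Proof.
move=> nb.
have [di|di] := determines_dec i l; first by apply: kills_determined di; rewrite mem_head.
have [dk|dk] := determines_dec k l; first by apply: kills_determined dk; rewrite !inE eqxx orbT.
have [ul|[t]] := uses_allPn l; last exact: kills_missing.
have [[r /nb//]|[p [q [r [pqr]]]]] := conn_pair ul di dk.
move=> /conn_even[u [uE ou ui ul_]] /conn_even[v [vE ov vk vl]].
apply: (kills_commutator ul pqr); rewrite -ul_ -vl; apply: reach_comm => //.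
by move=> s; rewrite !inE => /orP[] /eqP ->; rewrite ?ui ?vk ?comm1g ?commg1.
Qed.

(** The first two players can always be killed, so only the last two steps are assumed. *)
Lemma solvable_chain i j k l : uniq [:: l; k; j; i] ->
  kills [:: j; i] k -> kills [:: k; j; i] l -> solvable_set.
Proof.
move=> u hk hl w wadm.
pose P S v := [/\ admissible v, {in S, forall s, ev s v = 1%g} &
  forall e, odd (count_mem e v) = odd (count_mem e w)].
have step S m v : P S v -> kills S m -> exists v', P (m :: S) v'.
  case=> va vS vw hm; have [n [n0 nS nm]] := hm v va vS.
  exists (v ++ rev n); split; first by apply/admissible_cat/null_rev.
    move=> s; rewrite inE ev_cat ev_rev => /predU1P[->|sS].
      by rewrite nm mulgV.
    by rewrite vS // nS // invg1 mulg1.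
  by move=> e; rewrite count_cat oddD vw (null_count e (null_rev n0)) addbF.
have P0 : P [::] w by split.
have [v1 P1] := step _ i _ P0 (@kills0 i).
have [v2 P2] := step _ j _ P1 (@kills1 i j).
have [v3 P3] := step _ k _ P2 hk.
have [v4 [[vE _ _] v1' vw]] := step _ l _ P3 hl.
by exists v4; split=> // a; apply/wd1P/v1'/ord4_full.
Qed.

(** Player [l] comes last, where it is trivial for free; without shared bits the other three can be
    killed in turn. *)
Lemma solvable_determined i l : i != l -> (forall i j k, uniq [:: i; j; k] ->
   forall r, ~ shared_bit i j k r) ->
  (determines i l \/ exists t, {in E, forall e : clause, tnth e l != t}) -> solvable_set.
Proof.
move=> il nb h; have [j [k u]] := ord4_others il.
apply: (solvable_chain u).
  apply: kills2; apply: nb; move: u; rewrite /= !inE !negb_or !andbT.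
  by case/and3P=> _ /andP[kj ki] ji; rewrite ji ![_ == k]eq_sym kj ki.
case: h => [d|[t]]; last exact: kills_missing.
by apply: kills_determined d; rewrite !inE eqxx !orbT.
Qed.

End Words.

(** * Clause sets with a bit shared by three players *)

Lemma scount_sum (T : finType) (u : seq T) : \sum_(e : T) scount e u = (odd (size u))%:R.
Proof.
elim: u => [|x u IH] /=; first by rewrite big1.
rewrite big_split /= sumrN IH (bigD1 x) //= eqxx big1 ?addr0.
  by case: odd.
by move=> e /negbTE; rewrite eq_sym => ->.
Qed.

Lemma scount_notin (T : eqType) (e : T) u : e \notin u -> scount e u = 0.
Proof.
elim: u => //= x u IH; rewrite inE negb_or eq_sym => /andP[/negbTE-> /IH ->].
by rewrite subr0.
Qed.

(** Each clause other than [e0] gets its count from pairs [e e0] or [e0 e]; the count of [e0] is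
    then forced because both totals are zero. *)
Lemma scount_word (T : finType) (A : {pred T}) (e0 : T) (y : T -> int) :
  e0 \in A -> (forall e, e \notin A -> y e = 0) -> \sum_e y e = 0 ->
  exists u, [/\ {subset u <= A}, ~~ odd (size u) & forall e, scount e u = y e].
Proof.
move=> A0 yA ysum.
have piece e m : e \in A -> e != e0 -> exists u, [/\ {subset u <= A}, ~~ odd (size u),
    scount e u = m & forall f, f != e -> f != e0 -> scount f u = 0].
  move=> eA ee0; elim/int_stepind: m => [|m [u [uA ou ue uf]]|m [u [uA ou ue uf]]].
  - by exists [::].
  - exists [:: e, e0 & u]; split.
    + by move=> f; rewrite !inE => /or3P[/eqP->|/eqP->|/uA].
    + by rewrite /= negbK.
    + by rewrite /= eqxx [e0 == e]eq_sym (negbTE ee0) ue /=; ring.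
    + by move=> f fe f0; rewrite /= ![_ == f]eq_sym (negbTE fe) (negbTE f0) uf //=; ring.
  exists [:: e0, e & u]; split.
  - by move=> f; rewrite !inE => /or3P[/eqP->|/eqP->|/uA].
  - by rewrite /= negbK.
  - by rewrite /= eqxx [e0 == e]eq_sym (negbTE ee0) ue /=; ring.
  - by move=> f fe f0; rewrite /= ![_ == f]eq_sym (negbTE fe) (negbTE f0) uf //=; ring.
have pieces (s : seq T) : uniq s -> exists u, [/\ {subset u <= A}, ~~ odd (size u) &
    forall e, e != e0 -> scount e u = if e \in s then y e else 0].
  elim: s => [|x s IH] /=; first by exists [::].
  case/andP=> xs /IH[u [uA ou ue]].
  have [x0|x0] := eqVneq x e0.
    exists u; split=> // e e0'; rewrite ue // inE; case: eqVneq => // ex.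
    by rewrite ex x0 eqxx in e0'.
  have [xA|xA] := boolP (x \in A); last first.
    exists u; split=> // e e0'; rewrite ue // inE; case: eqVneq => // ->.
    by rewrite (negbTE xs) yA.
  have [v [vA ov vx vf]] := piece x (y x) xA x0.
  exists (v ++ u); split.
  - by move=> e; rewrite mem_cat => /orP[/vA|/uA].
  - by rewrite size_cat oddD (negbTE ov) (negbTE ou).
  move=> e e0'; rewrite scount_cat0 // ue // inE.
  have [->|ex] := eqVneq e x; first by rewrite vx (negbTE xs) addr0.
  by rewrite vf // add0r.
have [u [uA ou ue]] := pieces (enum T) (enum_uniq T).
exists u; split=> // e; have [->|ee0] := eqVneq e e0; last by rewrite ue // mem_enum.
have : \sum_e scount e u = \sum_e y e by rewrite scount_sum (negbTE ou) ysum.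
rewrite (bigD1 e0) //= [X in _ = X](bigD1 e0) //=.
rewrite (eq_bigr y) => [/addIr//|f fe0]; first by rewrite ue // mem_enum.
Qed.

Section SharedBit.
Variable E : {set clause}.
Implicit Types (a i j k l : 'I_4) (u v w n : seq clause).
Variable b : clause -> bool.

Definition separates a := {in E &, forall e f : clause, tnth e a = tnth f a -> b e = b f}.

Hypothesis b_onto : forall c, exists2 e, e \in E & b e = c.

Definition block c : {pred clause} := [pred e | (e \in E) && (b e == c)].

(** Within one block player [a] misses the questions of the other block, so at most two letters
    occur. *)
Lemma separates_ev a c u : separates a -> {subset u <= block c} ->
  (forall q, scount q (proj a u) = 0) -> ev a u = 1%g.
Proof.
move=> sa uc u0; have [g gE gc] := b_onto (~~ c).
apply: (missing_letter (t := tnth g a)) => // e /uc; rewrite inE => /andP[eE /eqP ec].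
by apply/eqP => /(sa _ _ eE gE); rewrite ec gc; case: (c).
Qed.

(** Pairs from one block use at most two letters of [a], so they commute. For different blocks the
    questions of [a] are disjoint, and as there are only three, one of the pairs repeats a question
    and is trivial. *)
Lemma separates_comm a c (e f e' f' : clause) : separates a ->
  e \in block c -> f \in block c -> forall c', e' \in block c' -> f' \in block c' ->
  [~ ev a [:: e; f], ev a [:: e'; f']]%g = 1%g.
Proof.
move=> sa; rewrite !inE => /andP[eE /eqP ec] /andP[fE /eqP fc] c'.
rewrite !inE => /andP[eE' /eqP ec'] /andP[fE' /eqP fc'].
have [cc|cc] := eqVneq c c'.
  have nn := null_comm (sub_pair eE fE) (sub_pair eE' fE') isT isT.
  have [_ _ n0] := null_admissible nn.
  have := separates_ev (c := c) sa _ (n0 a).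
  rewrite !ev_cat !ev_rev commgEl conjgE !mulgA; apply.
  move=> g; rewrite !(mem_cat, mem_rev, inE).
  by do ![case/orP]=> /eqP->; rewrite ?eE ?fE ?eE' ?fE' ?ec ?fc ?ec' ?fc' ?cc eqxx.
have [ef|ef] := eqVneq (tnth e a) (tnth f a).
  by rewrite ev_pair ef wd_gg comm1g.
have [ef'|ef'] := eqVneq (tnth e' a) (tnth f' a).
  by rewrite [ev a [:: e'; f']]ev_pair ef' wd_gg commg1.
have ne g h : g \in E -> h \in E -> b g = c -> b h = c' -> tnth g a != tnth h a.
  by move=> gE hE gc hc; apply/eqP => /(sa _ _ gE hE); rewrite gc hc; apply/eqP.
have /card_uniqP : uniq [:: tnth e a; tnth f a; tnth e' a; tnth f' a].
  by rewrite /= !inE !negb_or ef ef' !ne.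
move=> /= h.
have := max_card (mem [:: tnth e a; tnth f a; tnth e' a; tnth f' a]).
by rewrite card_ord h.
Qed.

(** Cutting the signed counts of [w] along [b] gives one word per block, trivial for [i], [j] and
    [k]; only [l] is left to kill. *)
Lemma solvable_separated i j k l : uniq [:: l; k; j; i] ->
  separates i -> separates j -> separates k -> solvable_set E.
Proof.
move=> u4 si sj sk w [wE ow w0].
pose y c e := if b e == c then scount e w else 0.
have yE c e : e \notin block c -> y c e = 0.
  rewrite inE negb_and /y => /orP[eE|/negbTE->] //.
  by rewrite scount_notin ?if_same //; apply: contra eE => /wE.
(* All clauses asking [a] the question [q] lie in one block, so the restricted sum is either the
   full one or empty. *)
have ysep a c q : separates a -> \sum_(e : clause | tnth e a == q) y c e = 0.
  move=> sa.
  have [/exists_inP[f fE /andP[/eqP fq /eqP fc]]|] :=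
     boolP [exists f in E, (tnth f a == q) && (b f == c)].
    rewrite -[RHS](w0 a q) scount_proj; apply: eq_bigr => e /eqP eq.
    rewrite /y; case: eqP => // ec; rewrite scount_notin //.
    by apply/negP => /wE eE; case: ec; rewrite -fc; apply: sa; rewrite // eq fq.
  rewrite negb_exists_in => /forall_inP nf; apply: big1 => e eq.
  apply: yE; rewrite inE; apply/negP => /andP[eE ec].
  by have := nf e eE; rewrite eq ec.
have ysum c : \sum_e y c e = 0.
  rewrite (partition_big (fun e : clause => tnth e k) predT) //=.
  by apply: big1 => q _; apply: ysep.
have [e0 e0E b0] := b_onto false; have [e1 e1E b1] := b_onto true.
have [u [uA ou us]] : exists u,
    [/\ {subset u <= block false}, ~~ odd (size u) & forall e, scount e u = y false e].
  by apply: (scount_word (e0 := e0)) (yE false) (ysum false); rewrite inE e0E b0.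
have [v [vA ov vs]] : exists u,
    [/\ {subset u <= block true}, ~~ odd (size u) & forall e, scount e u = y true e].
  by apply: (scount_word (e0 := e1)) (yE true) (ysum true); rewrite inE e1E b1.
have bE c z : {subset z <= block c} -> {subset z <= E}.
  by move=> h e /h; rewrite inE => /andP[].
have uvs e : scount e (u ++ v) = scount e w.
  by rewrite scount_cat0 // us vs /y; case: (b e); rewrite ?addr0 ?add0r.
have uva : admissible E (u ++ v).
  split; first by apply: sub_cat; [apply: bE uA|apply: bE vA].
    by rewrite size_cat oddD (negbTE ou) (negbTE ov).
  by move=> a q; rewrite -[RHS](w0 a q) !scount_proj; apply: eq_bigr.
have evs a : separates a -> ev a (u ++ v) = 1%g.
  move=> sa; rewrite ev_cat (separates_ev sa uA) ?(separates_ev sa vA) ?mulg1 //.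
    by move=> q; rewrite scount_proj -[RHS](ysep a true q sa); apply: eq_bigr.
  by move=> q; rewrite scount_proj -[RHS](ysep a false q sa); apply: eq_bigr.
have sS : {in [:: i; j; k], forall s, separates s}.
  by move=> s; rewrite !inE => /or3P[] /eqP->.
have [n [n0 nS nl]] : reach E [:: i; j; k] l (ev l (u ++ v)).
  have [ul|[t ht]] := uses_allPn E l; last first.
    rewrite (missing_letter (t := t)); first by exists [::]; split=> //; apply: null_nil.
      by have [uvE _ _] := uva; move=> e /uvE; apply: ht.
    by have [_ _ uv0] := uva.
  have [/forall_inP sl|] := boolP [forall e in E, forall f in E,
     (tnth e l == tnth f l) ==> (b e == b f)].
    rewrite (evs l); first by exists [::]; split=> //; apply: null_nil.
    move=> e f eE fE ef; have /forall_inP/(_ f fE) := sl e eE.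
    by rewrite ef eqxx => /eqP.
  rewrite negb_forall => /existsP[g]; rewrite negb_imply => /andP[gE].
  rewrite negb_forall => /existsP[h]; rewrite negb_imply => /andP[hE].
  rewrite negb_imply => /andP[/eqP gh bgh].
  (* The question of [g] at [l] is asked in both blocks, so any clause can be paired, inside its own
     block, with one asking it. *)
  have base c : exists2 e, e \in block c & tnth e l = tnth g l.
    have [gc|gc] := eqVneq (b g) c; first by exists g; rewrite // inE gE gc eqxx.
    by exists h; rewrite // inE hE; move: bgh gc; case: (b g); case: (b h); case: c.
  have [q [r pqr]] : exists q r, uniq [:: tnth g l; q; r].
    have [q [r qr]] := ord3_others (tnth g l); exists q, r.
    by rewrite -(rot_uniq 1) .
  have [f fE fq] := ul q; have [f' fE' fr] := ul r.
  have [e eB ep] := base (b f); have [e' eB' ep'] := base (b f').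
  apply: (kills_commutator ul pqr _ uva) => //.
    have -> : ('x_(tnth g l) * 'x_q = ev l [:: e; f])%g by rewrite ev_pair ep fq.
    have -> : ('x_(tnth g l) * 'x_r = ev l [:: e'; f'])%g by rewrite ev_pair ep' fr.
    have sB c x : x \in block c -> x \in E by rewrite inE => /andP[].
    apply: reach_comm => //; try by apply: sub_pair => //; apply: sB; eassumption.
    move=> s /sS sa; apply: separates_comm sa eB _ _ eB' _; by rewrite inE ?fE ?fE' eqxx.
  by move=> s /sS /evs.
exists ((u ++ v) ++ rev n); split.
- have [uvE _ _] := uva; have [nE _ _] := n0.
  by apply: sub_cat => //; apply: sub_rev.
- move=> a; apply/wd1P; rewrite -[LHS]/(ev a _) ev_cat ev_rev.
  have := ord4_full a u4 erefl; rewrite inE => /predU1P[->|ha]; first by rewrite nl mulgV.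
  have hS : a \in [:: i; j; k] by move: ha; rewrite -mem_rev.
  by rewrite (evs a (sS a hS)) (nS a hS) invg1 mulg1.
move=> e; rewrite count_cat oddD (null_count e (null_rev n0)) addbF.
by rewrite -!scount_odd uvs.
Qed.

End SharedBit.

Lemma solvable_shared E i j k l r : uniq [:: l; k; j; i] ->
  shared_bit E i j k r -> solvable_set E.
Proof.
move=> u4 [uk sb]; pose b (e : clause) := tnth e k == r.
have on c : exists2 e : clause, e \in E & b e = c.
  case: c; first by have [e eE er] := uk r; exists e; rewrite // /b er eqxx.
  have [p [q pqr]] := ord3_others r; have [e eE ep] := uk p; exists e => //.
  by rewrite /b ep; move: pqr; rewrite /= !inE negb_or => /andP[/andP[_ /negbTE]].
apply: (solvable_separated on u4) => //.
- by move=> e f eE fE ef; apply: sb; [..|left].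
- by move=> e f eE fE ef; apply: sb; [..|right].
- by move=> e f eE fE; rewrite /b => ->.
Qed.

Definition structured (E : {set clause}) :=
  [\/ exists l t, {in E, forall e : clause, tnth e l != t},
      exists i l, i != l /\ determines E i l |
      exists i j k r, uniq [:: i; j; k] /\ determines_bit E i j k r].

(** A shared bit is handled by splitting. Without one, a bit that two players determine at a third
    forces that third player to miss a question. *)
Lemma solvable_structured E : structured E -> solvable_set E.
Proof.
have [[i [j [k [r [u3 sb]]]]] _|ns] :=
    boolp.EM (exists i j k r, uniq [:: i; j; k] /\ shared_bit E i j k r).
  have [l hl] := @ord4_fresh [:: k; j; i] isT; apply: (solvable_shared (l := l) _ sb).
  by rewrite [uniq _](cons_uniq l [:: k; j; i]) hl -(rev_uniq [:: k; j; i]).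
have nb i j k : uniq [:: i; j; k] -> forall r, ~ shared_bit E i j k r.
  by move=> u3 r sb; apply: ns; exists i, j, k, r.
have missing l t : {in E, forall e : clause, tnth e l != t} -> solvable_set E.
  move=> h; have [i] := @ord4_fresh [:: l] isT; rewrite inE => il.
  by apply: (solvable_determined il nb); right; exists t.
case=> [[l [t]]|[i [l [il d]]]|[i [j [k [r [u3 sb]]]]]].
- exact: missing.
- by apply: (solvable_determined il nb); left.
have [uk|[t]] := uses_allPn E k; last exact: missing.
by have := nb _ _ _ u3 r (conj uk sb).
Qed.

(** * Clause sets with a triple of clauses rainbow for an odd number of players *)

Lemma area_rev (T : eqType) (q r : T) u : q != r -> ~~ odd (size u) ->
  (forall t, scount t u = 0) -> area q r (rev u) = - area q r u.
Proof.
move=> qr ou u0.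
have c : cancels (rev u ++ u).
  elim: {ou u0} u => [|x u IH]; first exact: cancels_nil.
  by rewrite rev_cons cat_rcons; apply: cancels_pair.
have := area_cancels qr c; rewrite area_cat u0 mulr0 addr0 => /eqP.
by rewrite addr_eq0 => /eqP.
Qed.

Lemma area_wd (T : choiceType) (q r : T) u v : q != r ->
  ~~ odd (size u) -> ~~ odd (size v) -> (forall t, scount t u = 0) ->
  (forall t, scount t v = 0) -> wd u = wd v -> area q r u = area q r v.
Proof.
move=> qr ou ov u0 v0 uv; have /wd1P c : wd (u ++ rev v) = 1%g.
  by rewrite wd_cat wd_rev uv mulgV.
have := area_cancels qr c; rewrite area_cat u0 mulr0 mul0r addr0 area_rev // => /eqP.
by rewrite subr_eq0 => /eqP.
Qed.

Lemma odd_parity (x : int) : exists h : int, x = 2 * h + (odd `|x|%N)%:R.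
Proof. by exists (x %/ 2)%Z; case: (boolP (odd _)) => o /=; lia. Qed.

Lemma odd_abszD (x y : int) : odd `|(x + y)%R|%N = odd `|x|%N (+) odd `|y|%N.
Proof. by lia. Qed.

Lemma odd_double_subr (h y : int) : odd `|(1 + - y * (2 * h))%R|%N.
Proof. by rewrite odd_abszD !abszM !oddM /= andbF. Qed.

Lemma odd_combination (a b c d h1 h2 h3 : int) :
  odd `|a|%N (+) odd `|b|%N (+) odd `|c|%N (+) odd `|d|%N ->
  odd `|(d + (- a * (2 * h1 + 1) + (- b * (2 * h2 + 1) + - c * (2 * h3 + 1))))%R|%N.
Proof.
rewrite !(odd_abszD, abszM, abszN, oddM) /= !andbT.
by do 4!case: (odd _).
Qed.

Section Generic.
Variable E : {set clause}.
Implicit Types (S : seq 'I_4) (a i j k l : 'I_4) (u v w n : seq clause).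

Hypothesis ua : forall l, uses_all E l.
Hypothesis nd : forall i l, i != l -> ~ determines E i l.
Hypothesis nb : forall i j k, uniq [:: i; j; k] -> forall r, ~ shared_bit E i j k r.

Lemma reach_closed i k l s : uniq [:: i; k; l] -> ~~ odd (size s) ->
  (forall t, scount t s = 0) -> reach E [:: i; k] l (wd s).
Proof.
move=> u3 os s0; have := u3; rewrite /= !inE !negb_or !andbT => /andP[/andP[ik il] kl].
have [[r h]|[p [q [r [pqr]]]]] := conn_pair (ua l) (nd il) (nd kl); first by case: (nb u3 h).
move=> /conn_even[u [uE ou ui ul]] /conn_even[v [vE ov vk vl]].
apply: (commutator_collection (reach_normal _ (ua l)) pqr) => //.
  rewrite -ul -vl; apply: reach_comm => //.
  by move=> t; rewrite !inE => /orP[] /eqP ->; rewrite ?ui ?vk ?comm1g ?commg1.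
by move=> x _; apply: ord3_full.
Qed.

Definition cword (p q r : 'I_3) := [:: q; p; r; p; p; q; p; r].

Lemma cwordE p q r : wd (cword p q r) = [~ 'x_p * 'x_q, 'x_p * 'x_r]%g.
Proof.
have -> : cword p q r = rev [:: p; q] ++ rev [:: p; r] ++ [:: p; q] ++ [:: p; r] by [].
by rewrite 3!wd_cat !wd_rev !(wd_cons p [:: _]) commgEl conjgE.
Qed.

Lemma scount_cword p q r t : scount t (cword p q r) = 0.
Proof. by rewrite /=; ring. Qed.

Lemma area_cword p q r : uniq [:: p; q; r] -> area q r (cword p q r) = 1.
Proof.
rewrite /= !inE !negb_or !andbT => /andP[/andP[/negbTE pq /negbTE pr] /negbTE qr].
have [qp rq] : q == p = false /\ r == q = false by rewrite eq_sym pq eq_sym qr.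
by rewrite !eqxx ?pq ?pr ?qr ?qp ?rq.
Qed.

Definition others l := [seq a <- enum 'I_4 | a != l].

(** [L] selects free generators of the even part whose commutator is central modulo
    [reach E (others l) l], as collection requires. *)
Definition central l (L : 'I_3 * 'I_3 * 'I_3) := let: (p, q, r) := L in
  [/\ uniq [:: p; q; r],
   reach E (others l) l [~ [~ 'x_p * 'x_q, 'x_p * 'x_r], 'x_p * 'x_q]%g &
   reach E (others l) l [~ [~ 'x_p * 'x_q, 'x_p * 'x_r], 'x_p * 'x_r]%g].

Lemma reach_sub S S' l g : {subset S' <= S} -> reach E S l g -> reach E S' l g.
Proof. by move=> h [n [n0 nS nl]]; exists n; split=> // s /h /nS. Qed.

Lemma others_sub i j k l : uniq [:: l; k; j; i] -> {subset others l <= [:: i; j; k]}.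
Proof.
move=> u4 a; rewrite mem_filter => /andP[al _].
by have := ord4_full a u4 erefl; rewrite inE (negbTE al) /= -mem_rev.
Qed.

(** The generators come from words trivial for [i] and for [j]. Their commutator is reached with
    [j], [k] trivial and also with [i], [k] trivial, so its commutator with either generator is
    reached with all three trivial. *)
Lemma central_exists l : exists L, central l L.
Proof.
have [i il] : exists i, i != l.
  have /card_gt0P[i] : (0 < #|~: [set l]|)%N by rewrite cardsC1 card_ord.
  by rewrite !inE; exists i.
have [j [k u4]] := ord4_others il.
have := u4; rewrite /= !inE !negb_or !andbT.
case/andP=> /and3P[lk lj li] /andP[/andP[kj ki] ji].
have uijl : uniq [:: i; j; l].
  by rewrite /= !inE negb_or ![_ == l]eq_sym li lj eq_sym ji.
have ujkl : uniq [:: j; k; l].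
  by rewrite /= !inE negb_or ![_ == l]eq_sym lk lj eq_sym kj.
have uikl : uniq [:: i; k; l].
  by rewrite /= !inE negb_or ![_ == l]eq_sym lk li eq_sym ki.
have jl : j != l by rewrite eq_sym.
have [[r h]|[p [q [r [pqr]]]]] := conn_pair (ua l) (nd il) (nd jl).
  by case: (nb uijl h).
move=> /conn_even[u [uE ou ui ul]] /conn_even[v [vE ov vj vl]].
exists (p, q, r); split=> //; rewrite -cwordE.
  have [n [[nE on _] nS <-]] := reach_closed (s := cword p q r) ujkl isT (scount_cword p q r).
  rewrite -ul; apply: reach_sub (others_sub u4) _; apply: reach_comm => //.
  move=> s; rewrite !inE => /or3P[] /eqP->; rewrite ?ui ?commg1 // nS ?comm1g //.
    by rewrite !inE eqxx.
  by rewrite !inE eqxx orbT.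
have [n [[nE on _] nS <-]] := reach_closed (s := cword p q r) uikl isT (scount_cword p q r).
rewrite -vl; apply: reach_sub (others_sub u4) _; apply: reach_comm => //.
move=> s; rewrite !inE => /or3P[] /eqP->; rewrite ?vj ?commg1 // nS ?comm1g //.
  by rewrite !inE eqxx.
by rewrite !inE eqxx orbT.
Qed.

Section Labels.
Variable lab : 'I_4 -> 'I_3 * 'I_3 * 'I_3.
Hypothesis labP : forall l, central l (lab l).

Definition ar l w := area (lab l).1.2 (lab l).2 (proj l w).

Lemma lab_uniq l : uniq [:: (lab l).1.1; (lab l).1.2; (lab l).2].
Proof. by have := labP l; rewrite /central; case: (lab l) => [[p q] r] []. Qed.

Lemma lab_neq l : (lab l).1.2 != (lab l).2.
Proof. by have := lab_uniq l; rewrite /= !inE => /and3P[]. Qed.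

Lemma ar_cat l u v : admissible E u -> ar l (u ++ v) = ar l u + ar l v.
Proof. by case=> _ _ u0; rewrite /ar proj_cat area_cat u0 mulr0 mul0r addr0. Qed.

Lemma ar_rev l u : admissible E u -> ar l (rev u) = - ar l u.
Proof.
case=> _ ou u0; rewrite /ar /proj map_rev area_rev ?size_map //.
  exact: lab_neq.
exact: u0.
Qed.

Lemma ar_ev1 l w : ev l w = 1%g -> ar l w = 0.
Proof. by move/wd1P/area_cancels; apply; apply: lab_neq. Qed.

(** Modulo elements reached with the others trivial, the projection is a power of the basic
    commutator whose exponent is the area. *)
Lemma reach_ar0 l w : admissible E w -> ar l w = 0 -> reach E (others l) l (ev l w).
Proof.
case=> _ ow w0; have := labP l; rewrite /central /ar.
case: (lab l) => [[p q] r] [pqr za zb] /= a0.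
have nD := reach_normal (others l) (ua l).
have := collection0 nD pqr za zb (u := proj l w).
rewrite a0 size_map => /(_ (fun x _ => ord3_full x pqr) ow (w0 l)).
by move/(eqmod_sym nD)/eqmod1.
Qed.

Definition realized (f : 'I_4 -> int) := exists2 n, null E n & forall l, ar l n = f l.

Lemma realized_ext f g : f =1 g -> realized f -> realized g.
Proof. by move=> fg [n n0 h]; exists n => // l; rewrite h fg. Qed.

Lemma realizedD f g : realized f -> realized g -> realized (fun l => f l + g l).
Proof.
move=> [m m0 mf] [n n0 nf]; exists (m ++ n); first exact: null_cat.
by move=> l; rewrite ar_cat ?mf ?nf //; apply: null_admissible.
Qed.

Lemma realizedN f : realized f -> realized (fun l => - f l).
Proof.
move=> [m m0 mf]; exists (rev m); first exact: null_rev.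
by move=> l; rewrite ar_rev ?mf //; apply: null_admissible.
Qed.

Lemma realizedM f (m : int) : realized f -> realized (fun l => m * f l).
Proof.
move=> hf; elim/int_stepind: m => [|m IH|m IH].
- exists [::]; first exact: null_nil.
  by move=> l; rewrite mul0r.
- by apply: realized_ext (realizedD IH hf) => l; ring.
by apply: realized_ext (realizedD IH (realizedN hf)) => l; ring.
Qed.

(** The basic commutator at [l] is reached with [i] and [j] trivial; the coordinate of the fourth
    player is not controlled. *)
Lemma realized_unit i j l : uniq [:: i; j; l] ->
  exists f, [/\ realized f, f l = 1, f i = 0 & f j = 0].
Proof.
move=> u3; pose L := lab l.
have [n [n0 nS nl]] := reach_closed (s := cword L.1.1 L.1.2 L.2) u3 isT (scount_cword _ _ _).
exists (ar ^~ n); split; first by exists n.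
- have [_ on nc] := null_admissible n0.
  rewrite -(area_cword (lab_uniq l)); apply: area_wd nl => //.
  + exact: lab_neq.
  + by rewrite size_map.
  exact: scount_cword.
- by apply/ar_ev1/nS; rewrite inE eqxx.
by apply/ar_ev1/nS; rewrite !inE eqxx orbT.
Qed.

Definition rainbow (p q r : 'I_3) := [&& p != q, p != r & q != r].

(** The word spells the commutator of the pairs [s t] and [s u], which is trivial as soon as two of
    the questions agree. *)
Lemma area_rainbow (p q r s t u : 'I_3) : uniq [:: p; q; r] ->
  odd `|area q r [:: t; s; u; s; s; t; s; u]|%N = rainbow s t u.
Proof.
move=> pqr; have := (ord3_full s pqr, ord3_full t pqr, ord3_full u pqr).
move: pqr; rewrite /rainbow /= !inE !negb_or !andbT.
case/andP=> /andP[/negbTE pq /negbTE pr] /negbTE qr [[]].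
have qp : q == p = false by rewrite eq_sym.
have rp : r == p = false by rewrite eq_sym.
have rq : r == q = false by rewrite eq_sym.
by do 3![case/or3P=> /eqP ->]; rewrite ?eqxx ?pq ?pr ?qr ?qp ?rp ?rq.
Qed.

Lemma realized_odd (e f g : clause) : e \in E -> f \in E -> g \in E ->
  exists2 F, realized F & forall l, odd `|F l|%N = rainbow (tnth e l) (tnth f l) (tnth g l).
Proof.
move=> eE fE gE; exists (ar ^~ (rev [:: e; f] ++ rev [:: e; g] ++ [:: e; f] ++ [:: e; g])).
  eexists; last by [].
  by apply: null_comm => //; apply: sub_pair.
by move=> l; apply: area_rainbow (lab_uniq l).
Qed.

Lemma admissible_power w T : admissible E w -> exists v, [/\ admissible E v,
  forall l, ar l v = T%:Z * ar l w & forall e, count_mem e v = (T * count_mem e w)%N].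
Proof.
move=> hw; elim: T => [|T [v [va vr vc]]].
  by exists [::]; split=> // l; rewrite mul0r.
have [wE ow w0] := hw; have [vE ov v0] := va.
exists (w ++ v); split.
- split; first exact: sub_cat.
    by rewrite size_cat oddD (negbTE ow) (negbTE ov).
  by move=> a q; rewrite proj_cat scount_cat0 ?size_map // w0 v0.
- by move=> l; rewrite ar_cat // vr -addn1 PoszD; ring.
by move=> e; rewrite count_cat vc mulSn.
Qed.

(** This is the odd index: together with the vectors of [realized_unit], a vector with odd entry at
    [l] and zeros elsewhere generates a subgroup of odd index in [Z^4]. *)
Lemma realized_last i j k l (e f g : clause) : uniq [:: l; k; j; i] ->
  e \in E -> f \in E -> g \in E ->
  let rb a := rainbow (tnth e a) (tnth f a) (tnth g a) in
  rb i (+) rb j (+) rb k (+) rb l ->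
  exists F (T : nat), [/\ realized F, odd T, F l = T%:Z & [/\ F i = 0, F j = 0 & F k = 0]].
Proof.
move=> u4 eE fE gE rb hrb.
have u : [/\ uniq [:: j; k; i], uniq [:: i; k; j] & uniq [:: i; j; k]]
      /\ [/\ uniq [:: j; k; l], uniq [:: i; k; l] & uniq [:: i; j; l]].
  move: u4; rewrite /= !inE !negb_or !andbT.
  case/andP=> /and3P[lk lj li] /andP[/andP[kj ki] ji].
  have [kl jl il] : [/\ k != l, j != l & i != l] by split; rewrite eq_sym.
  have [jk ik ij] : [/\ j != k, i != k & i != j].
    by split; rewrite eq_sym.
  by rewrite kj ki ji jk ik ij kl jl il.
have [[ui uj uk] [ui' uj' uk']] := u.
suff [F [hF oF Fi Fj Fk]] : exists F, [/\ realized F, odd `|F l|%N, F i = 0, F j = 0 & F k = 0].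
  case eFl: (F l) oF => [T|T] oT; first by exists F, T.
  exists (fun a => - F a), T.+1; split=> //; first exact: realizedN.
    by rewrite eFl NegzE opprK.
  by rewrite Fi Fj Fk oppr0.
(* If the unit vector [V] at [a] is even at [l], subtracting a multiple of it from a unit vector at
   [l] clears [a] and leaves an odd entry at [l], which finishes the proof. *)
have single a b c : uniq [:: b; c; a] -> uniq [:: b; c; l] ->
  (exists V, [/\ realized V, V a = 1, V b = 0, V c = 0 & odd `|V l|%N]) \/
  exists F, [/\ realized F, odd `|F l|%N, F a = 0, F b = 0 & F c = 0].
  move=> u1 u2; have [V [hv va vb vc]] := realized_unit u1.
  have [y [hy yl yb yc]] := realized_unit u2.
  case: (boolP (odd `|V l|%N)) => ov; [left|right]; first by exists V.
  exists (fun t => y t + - y a * V t); split.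
  - exact: realizedD hy (realizedM (- y a) hv).
  - have [h ->] := odd_parity (V l).
    by rewrite yl (negbTE ov) addr0; apply: odd_double_subr.
  - by rewrite va; ring.
  - by rewrite yb vb; ring.
  by rewrite yc vc; ring.
have [[vi [hi ii ij ik oi]]|[F [hF oF Fi Fj Fk]]] := single _ _ _ ui ui'; last by exists F.
have [[vj [hj jj ji jk oj]]|[F [hF oF Fi Fj Fk]]] := single _ _ _ uj uj'; last by exists F.
have [[vk [hk kk ki kj ok]]|[F [hF oF Fi Fj Fk]]] := single _ _ _ uk uk'; last by exists F.
(* All three unit vectors are now odd at [l]. Clearing the rainbow vector with them leaves at [l]
   the parity of the sum of its four entries. *)
have [r hr ro] := realized_odd eE fE gE.
exists (fun a => r a + (- r i * vi a + (- r j * vj a + - r k * vk a))); split.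
- by apply: realizedD => //; apply: realizedD; [|apply: realizedD]; apply: realizedM.
- have [[h1 ->] [h2 ->] [h3 ->]] := And3 (odd_parity (vi l)) (odd_parity (vj l)) (odd_parity (vk l)).
  by rewrite oi oj ok; apply: odd_combination; move: hrb; rewrite /rb -!ro.
- by rewrite ii ji ki; ring.
- by rewrite ij jj kj; ring.
by rewrite ik jk kk; ring.
Qed.

End Labels.

Lemma solvable_rainbow i j k l (e f g : clause) : uniq [:: l; k; j; i] ->
  e \in E -> f \in E -> g \in E ->
  let rb a := rainbow (tnth e a) (tnth f a) (tnth g a) in
  rb i (+) rb j (+) rb k (+) rb l -> solvable_set E.
Proof.
move=> u4 eE fE gE rb hrb w wa.
have [lab labP] := fin_all_exists central_exists.
have [F [T [hF oT Fl [Fi Fj Fk]]]] := realized_last labP u4 eE fE gE hrb.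
have all4 a : a \in [:: l; k; j; i] by apply: ord4_full.
have [v [va vr vc]] := admissible_power lab T wa.
have [n n0 nr] : realized lab (fun a => T%:Z * ar lab a w).
  have unit a b c : uniq [:: b; c; a] -> exists V, [/\ realized lab V, V a = 1, V b = 0 & V c = 0].
    by move=> u3; exact: realized_unit.
  have u := u4; move: u; rewrite /= !inE !negb_or !andbT.
  case/andP=> _ /andP[/andP[kj ki] ji].
  have [ik jk ij] : [/\ i != k, j != k & i != j] by split; rewrite eq_sym.
  have [V [hV ii ij0 ik0]] := unit i j k ltac:(by rewrite /= !inE negb_or jk ji ki).
  have [Y [hY jj ji0 jk0]] := unit j i k ltac:(by rewrite /= !inE negb_or ik ij kj).
  have [Z [hZ kk ki0 kj0]] := unit k i j ltac:(by rewrite /= !inE negb_or ij ik jk).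
  pose c a := ar lab a w.
  (* The unit vectors match the entries at [i], [j], [k]; the error at [l] is a multiple of [T],
     which a multiple of [F] removes. *)
  apply: (realized_ext (f := fun a => T%:Z * c i * V a + (T%:Z * c j * Y a +
    (T%:Z * c k * Z a + (c l - c i * V l - c j * Y l - c k * Z l) * F a)))).
    move=> a; have := all4 a; rewrite !inE -/(c a) => /or4P[] /eqP ->.
    - by rewrite Fl; ring.
    - by rewrite Fk ik0 jk0 kk; ring.
    - by rewrite Fj ij0 jj kj0; ring.
    by rewrite Fi ii ji0 ki0; ring.
  by do 3![apply: realizedD; first exact: realizedM]; apply: realizedM.
have v2a : admissible E (v ++ rev n) by apply/admissible_cat/null_rev.
have v2r a : ar lab a (v ++ rev n) = 0.
  by rewrite ar_cat // ar_rev ?vr ?nr ?subrr //; apply: null_admissible.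
(* With all areas zero, each player is corrected by a null word trivial for the other three, so the
   corrections do not interfere. *)
have [m mP] := fin_all_exists (fun a => reach_ar0 labP v2a (v2r a)).
have mN a b : ev b (rev (m a)) = if b == a then (ev b (v ++ rev n))^-1%g else 1%g.
  have [_ mO me] := mP a; rewrite ev_rev; case: eqVneq => [->|ba]; first by rewrite me.
  by rewrite mO ?invg1 // mem_filter ba mem_enum.
have m0 a : null E (rev (m a)) by have [h _ _] := mP a; apply: null_rev.
pose t := rev (m i) ++ rev (m j) ++ rev (m k) ++ rev (m l).
have t0 : null E t by do 3![apply: null_cat => //].
exists ((v ++ rev n) ++ t); split.
- have [h _ _] := v2a; have [h' _ _] := t0; exact: sub_cat.
- move=> a; apply/wd1P; rewrite -[LHS]/(ev a _) ev_cat.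
  have := all4 a; have u := u4; move: u; rewrite /t 3![ev a (rev (m _) ++ _)]ev_cat !mN.
  rewrite /= !inE !negb_or !andbT.
  case/andP=> /and3P[lk lj li] /andP[/andP[kj ki] ji] /or4P[] /eqP ->.
  - by rewrite (negbTE li) (negbTE lj) (negbTE lk) eqxx !mul1g mulgV.
  - by rewrite (negbTE ki) (negbTE kj) [k == l]eq_sym (negbTE lk) eqxx !mul1g mulg1 mulgV.
  - by rewrite (negbTE ji) [j == k]eq_sym (negbTE kj) [j == l]eq_sym (negbTE lj) eqxx
      !mul1g !mulg1 mulgV.
  by rewrite [i == j]eq_sym [i == k]eq_sym [i == l]eq_sym (negbTE ji) (negbTE ki) (negbTE li)
    eqxx !mulg1 mulgV.
move=> e'; rewrite (count_cat _ (v ++ rev n)) count_cat !oddD.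
by rewrite (null_count e' t0) (null_count e' (null_rev n0)) !addbF vc oddM oT.
Qed.
End Generic.

(** * Clause sets all of whose triples are rainbow for an even number of players *)

Section Search.
Local Open Scope nat_scope.
Implicit Types (S P C X : seq (seq nat)) (x y z e f g : seq nat).
Local Notation at_ e a := (nth 0 e a).

(* [allb], [hasb] and the nested [if]s replace [all], [has] and the boolean
   connectives because the latter do not short-circuit under call by value. *)
Fixpoint allb (T : Type) (p : T -> bool) s :=
  if s is x :: s' then if p x then allb p s' else false else true.

Fixpoint hasb (T : Type) (p : T -> bool) s :=
  if s is x :: s' then if p x then true else hasb p s' else false.

Fixpoint findb (T : Type) (p : T -> bool) s :=
  if s is x :: s' then if p x then Some x else findb p s' else None.

Definition rainbow3 (a b c : nat) :=
  if eqn a b then false else if eqn a c then false else ~~ eqn b c.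

Fixpoint odd_rainbow x y z := match x, y, z with
  | a :: x, b :: y, c :: z => rainbow3 a b c (+) odd_rainbow x y z
  | _, _, _ => false
  end.

Definition players := [:: 0; 1; 2; 3].
Definition letters := [:: 0; 1; 2].

Definition missingb S :=
  hasb (fun l => hasb (fun t => allb (fun e => ~~ eqn (at_ e l) t) S) letters) players.

Definition determinesb S := hasb (fun i => hasb (fun l => if eqn i l then false else
  allb (fun e => allb (fun f =>
    if eqn (at_ e i) (at_ f i) then eqn (at_ e l) (at_ f l) else true) S) S)
  players) players.

Definition triples := 
  [seq t <- [seq (s, k) | s <- [:: (0, 1); (0, 2); (0, 3); (1, 2); (1, 3); (2, 3)],
                          k <- players] | uniq [:: t.1.1; t.1.2; t.2]].

Definition sharedb S := hasb (fun t => hasb (fun r =>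
    allb (fun e => allb (fun f =>
      if (if eqn (at_ e t.1.1) (at_ f t.1.1) then true else eqn (at_ e t.1.2) (at_ f t.1.2))
      then eqn (at_ e t.2) r == eqn (at_ f t.2) r else true) S) S) letters) triples.

Definition structuredb S :=
  if missingb S then true else if determinesb S then true else sharedb S.

(* The only clause of [S] with question [u] for player [a] has coefficient 0 in
   every kernel vector [y]. *)
Definition isolatedb S := hasb (fun a => hasb (fun u =>
  if [seq g <- S | at_ g a == u] is [:: e] then structuredb [seq g <- S | g != e] else false)
  letters) players.

(* If [e] and [f] are the only clauses of [S] with question [u] for player [a],
   then [y_e + y_f = 0]; the second condition is the equality of two further
   columns up to [e] and [f], which gives [y_e = y_f]. *)
Definition twinb S := hasb (fun a => hasb (fun u =>
  if [seq g <- S | at_ g a == u] is [:: e; f] then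
    if e == f then false else
    if hasb (fun b => hasb (fun v => hasb (fun c => hasb (fun w =>
      allb (fun g => (at_ g b == v) + (g == f) == (at_ g c == w) + (g == e)) S)
      letters) players) letters) players
    then structuredb [seq g <- S | g \notin [:: e; f]] else false
  else false) letters) players.

Definition tameb S :=
  if structuredb S then true else if isolatedb S then true else twinb S.

(* [C] collects clauses known to be in the set, [P] those that may be in it;
   triples containing the fixed clause [o] suffice to prune. *)
Fixpoint search n o C P := if n is n'.+1 then
  if structuredb (C ++ P) then true else
  if findb (fun v => hasb (odd_rainbow o v) P) P is Some v then
    let Q := [seq p <- P | p != v] in
    if search n' o C Q then search n' o (v :: C) [seq p <- Q | ~~ odd_rainbow o v p]
    else false
  else tameb (C ++ P)
  else false.

Definition codes := [seq a :: s | a <- letters, s <- [seq a :: s | a <- letters, s <-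
  [seq [:: a; b] | a <- letters, b <- letters]]].

Definition origin := [:: 0; 0; 0; 0].

(** The fuel 100 suffices: each recursive call removes a clause from [P], which starts with 81
    codes. *)
Lemma search_codes : search 100 origin [::] codes.
Proof. by vm_compute. Qed.

End Search.

Lemma allbE (T : Type) (p : T -> bool) s : allb p s = all p s.
Proof. by elim: s => //= x s ->; case: (p x). Qed.

Lemma hasbP (T : eqType) (p : T -> bool) s :
  reflect (exists2 x, x \in s & p x) (hasb p s).
Proof.
have -> : hasb p s = has p s by elim: s => //= x s ->; case: (p x).
exact: hasP.
Qed.

(** Whether or not [v] belongs to [X], the candidates kept still contain [X]. A tame superset is
    enough, as the structural conditions are universal over clauses and pass to subsets. *)
Lemma search_sound n o C P (X : pred (seq nat)) : search n o C P ->
  {subset X <= C ++ P} -> {in X &, forall x y, ~~ odd_rainbow o x y} ->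
  exists2 S, {subset X <= S} & tameb S.
Proof.
elim: n C P => //= n IH C P; case: ifP => [st _ XS _|_].
  by exists (C ++ P) => //; rewrite /tameb st.
case: findb => [v|ta XS _]; last by exists (C ++ P).
case: ifP => // s1 s2 XS Xe.
have [vX|vX] := boolP (v \in X).
  apply: (IH _ _ s2) => // x xX; have := XS x xX.
  rewrite !mem_cat inE mem_filter mem_filter (Xe v x vX xX) => /orP[->|->].
    by rewrite orbT.
  by rewrite andbT; case: (x == v); rewrite ?orbT.
apply: (IH _ _ s1) => // x xX; have := XS x xX.
rewrite !mem_cat mem_filter => /orP[->//|->]; rewrite andbT orbC.
by case: eqVneq => // xv; rewrite -xv xX in vX.
Qed.

(** Only signed counts matter, so [w] can be replaced by a word in [E'] with the same counts. *)
Lemma solvable_sub (E E' : {set clause}) : {subset E' <= E} ->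
  (forall w, admissible E w -> forall e, e \in E -> e \notin E' -> scount e w = 0) ->
  solvable_set E' -> solvable_set E.
Proof.
move=> sE h sol w wa; have [wE ow w0] := wa.
have wE' e : e \notin E' -> scount e w = 0.
  move=> nE; have [eE|eE] := boolP (e \in E); first exact: h.
  by apply: scount_notin; apply: contra eE => /wE.
have [[e0 e0E]|none] := boolp.EM (exists e, e \in E'); last first.
  exists [::]; split=> // [a|e]; first exact: cancels_nil.
  by rewrite -[RHS]scount_odd wE' //; apply/negP => ?; apply: none; exists e.
have wsum : \sum_e scount e w = 0 by rewrite scount_sum (negbTE ow).
have [u [uE ou us]] := scount_word (A := mem E') e0E wE' wsum.
have [|v [vE vb vc]] := sol u.
  split=> // a q; rewrite -[RHS](w0 a q) !scount_proj.
  by apply: eq_bigr => e _; rewrite us.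
exists v; split=> // [e /vE /sE//|e].
by rewrite vc -!scount_odd us.
Qed.

(** * Transfer of the search to clauses with relabelled questions *)

Section Codes.
Variables (E : {set clause}) (s : 'I_4 -> {perm 'I_3}).

Definition letter (a : 'I_4) (q : 'I_3) : nat := s a q.

Definition code (e : clause) : seq nat := [seq letter a (tnth e a) | a <- enum 'I_4].

Lemma nth_code e (a : 'I_4) : nth 0%N (code e) a = letter a (tnth e a).
Proof.
by rewrite (nth_map ord0) ?size_enum_ord // nth_ord_enum.
Qed.

Lemma letter_inj a : injective (letter a).
Proof. by move=> p q /val_inj /perm_inj. Qed.

Lemma letterP a t : t \in letters -> exists q, letter a q = t.
Proof.
move=> ht; have t3 : (t < 3)%N by move: ht; rewrite !inE => /or3P[] /eqP->.
by exists ((s a)^-1%g (Ordinal t3)); rewrite /letter permKV.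
Qed.

Lemma playerP a : a \in players -> exists i : 'I_4, a = i.
Proof.
move=> ht; have t4 : (a < 4)%N by move: ht; rewrite !inE => /or4P[] /eqP->.
by exists (Ordinal t4).
Qed.

Lemma code_inj : injective code.
Proof.
move=> e f ef; apply: eq_from_tnth => a; apply: (@letter_inj a).
by rewrite -!nth_code ef.
Qed.

Lemma structured_code S (E' : {set clause}) : {in E', forall e, code e \in S} ->
  structuredb S -> structured E'.
Proof.
move=> ES; rewrite /structuredb; case: ifP => [+ _|_].
  case/hasbP=> l /playerP[{}l ->] /hasbP[t tL]; rewrite allbE => /allP h.
  have [q qt] := letterP l tL; apply: Or31; exists l, q => e /ES /h.
  by rewrite nth_code eqnE -qt (inj_eq (@letter_inj l)).
case: ifP => [+ _|_].
  case/hasbP=> i /playerP[{}i ->] /hasbP[l /playerP[{}l ->]].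
  rewrite eqnE; case: eqVneq => // il; rewrite allbE => /allP h.
  apply: Or32; exists i, l; split=> // e f /ES /h + /ES fS ef.
  rewrite allbE => /allP/(_ _ fS); rewrite !nth_code ?eqnE ef eqxx => /eqP.
  exact: letter_inj.
case/hasbP=> [[[i j] k]] tT /hasbP[r rL]; rewrite allbE => /allP h.
have /allP/(_ _ tT)/and4P[/= u3 iP jP kP] : all (fun t => [&& uniq [:: t.1.1; t.1.2; t.2],
  t.1.1 \in players, t.1.2 \in players & t.2 \in players]) triples by [].
move: iP jP kP h u3 => /playerP[{tT}i' ->] /playerP[j' ->] /playerP[k' ->] h u3.
have [q qr] := letterP k' rL; apply: Or33; exists i', j', k', q; split.
  by rewrite -(map_inj_uniq val_inj).
move=> e f /ES /h + /ES fS ef.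
rewrite allbE => /allP/(_ _ fS); rewrite /= !nth_code !eqnE -qr !(inj_eq (@letter_inj _)).
case: ef => ->; rewrite eqxx; first by move/eqP.
by rewrite if_same => /eqP.
Qed.

(** The alternating sum of any function along a word, so that linear relations between columns can
    be checked clause by clause. *)
Fixpoint ssum (phi : seq nat -> int) (w : seq (seq nat)) : int :=
  if w is x :: w then phi x - ssum phi w else 0.

Lemma ssumD phi psi w : ssum (fun x => phi x + psi x) w = ssum phi w + ssum psi w.
Proof. by elim: w => //= x w ->; ring. Qed.

Lemma eq_ssum phi psi w : {in w, phi =1 psi} -> ssum phi w = ssum psi w.
Proof.
elim: w => //= x w IH h; rewrite h ?mem_head // IH // => y yw.
by apply: h; rewrite inE yw orbT.
Qed.

Lemma ssum_letter a u w : admissible E w -> u \in letters ->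
  ssum (fun x => (nth 0%N x a == u)%:R) (map code w) = 0 \/ a \notin players.
Proof.
case: (boolP (a \in players)) => [/playerP[{}a ->]|]; last by right.
move=> [_ _ w0] /(letterP a)[q <-]; left; rewrite -(w0 a q).
by elim: {w0} w => //= e w ->; rewrite nth_code (inj_eq (@letter_inj a)).
Qed.

Lemma ssum_code e w : ssum (fun x => (x == code e)%:R) (map code w) = scount e w.
Proof. by elim: w => //= f w ->; rewrite (inj_eq code_inj). Qed.

Lemma solvable_tame S : {in E, forall e, code e \in S} -> tameb S -> solvable_set E.
Proof.
move=> ES; rewrite /tameb; case: ifP => [st _|_].
  exact/solvable_structured/(structured_code ES).
case: ifP => [+ _|_].
  case/hasbP=> a aP /hasbP[u uL]; case eS: [seq g <- S | _] => [|x [|y s']] // st.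
  pose E' := [set e in E | code e != x].
  apply: (solvable_sub (E' := E')) => [e|w wa e eE|].
  - by rewrite inE => /andP[].
  - rewrite inE eE /= negbK => /eqP ex; have [wE _ _] := wa.
    have [|] := ssum_letter a wa uL; last by rewrite aP.
    rewrite -ssum_code => <-; apply: eq_ssum => z /mapP[f /wE fE ->].
    have := mem_filter (fun g => nth 0%N g a == u) (code f) S.
    by rewrite eS inE ES // andbT ex => ->.
  apply/solvable_structured/(structured_code _ st) => e; rewrite inE mem_filter.
  by case/andP=> eE ->; rewrite ES.
case/hasbP=> a aP /hasbP[u uL]; case eS: [seq g <- S | _] => [|x [|y [|]]] //.
case: eqVneq => // xy; case: ifP => // /hasbP[b bP /hasbP[v vL /hasbP[c cP /hasbP[t tL]]]].
rewrite allbE => /allP h st.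
pose E' := [set e in E | code e \notin [:: x; y]].
apply: (solvable_sub (E' := E')) => [e|w wa e eE|].
- by rewrite inE => /andP[].
- rewrite inE eE /= negbK => exy; have [wE _ _] := wa.
  have wS : {subset map code w <= S} by move=> z /mapP[f /wE /ES fE ->].
  have [|] := ssum_letter a wa uL; last by rewrite aP.
  have [|] := ssum_letter b wa vL; last by rewrite bP.
  have [|] := ssum_letter c wa tL; last by rewrite cP.
  set P := ssum _ _ => P0; set Q := ssum _ _ => Q0; set R := ssum _ _ => R0.
  (* [R = 0] makes the signed counts of the two clauses opposite, while [P = Q = 0] makes them
     equal, so both vanish. *)
  have e1 : R = ssum (fun z => (z == x)%:R) (map code w)
              + ssum (fun z => (z == y)%:R) (map code w).
    rewrite -ssumD; apply: eq_ssum => z zw.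
    have := mem_filter (fun g => nth 0%N g a == u) z S.
    rewrite eS !inE (wS z zw) andbT => <-; case: (eqVneq z x) => [->|] /=; last by rewrite add0r.
    by rewrite (negbTE xy).
  have e2 : Q + ssum (fun z => (z == y)%:R) (map code w) =
            P + ssum (fun z => (z == x)%:R) (map code w).
    rewrite -!ssumD; apply: eq_ssum => z zw; have /eqP := h z (wS z zw).
    by rewrite -!natrD => ->.
  by move: exy e1 e2; rewrite -ssum_code P0 Q0 R0 !inE => /orP[] /eqP ->; lia.
apply/solvable_structured/(structured_code _ st) => e; rewrite inE mem_filter.
by case/andP=> eE ->; rewrite ES.
Qed.

End Codes.

Section CodeWords.
Variable s : 'I_4 -> {perm 'I_3}.
Local Notation p0 := (ord0 : 'I_4).
Local Notation p1 := (lift ord0 (ord0 : 'I_3) : 'I_4).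
Local Notation p2 := (lift ord0 (lift ord0 (ord0 : 'I_2)) : 'I_4).
Local Notation p3 := (lift ord0 (lift ord0 (lift ord0 (ord0 : 'I_1))) : 'I_4).

Lemma codeE e : code s e = [:: letter s p0 (tnth e p0); letter s p1 (tnth e p1);
  letter s p2 (tnth e p2); letter s p3 (tnth e p3)].
Proof. by rewrite /code !enum_ordSl enum_ord0. Qed.

Lemma code_codes e : code s e \in codes.
Proof.
have lP a (q : 'I_3) : letter s a q \in letters.
  by rewrite /letter !inE; case: (s a q) => [[|[|[|]]]].
rewrite codeE; apply: allpairs_f => //; apply: allpairs_f => //.
exact: (@allpairs_f _ _ _ (fun a b => [:: a; b])).
Qed.

Lemma rainbow_code (e f g : clause) :
  let rb a := rainbow (tnth e a) (tnth f a) (tnth g a) in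
  odd_rainbow (code s e) (code s f) (code s g) = rb p0 (+) rb p1 (+) rb p2 (+) rb p3.
Proof.
have rE a p q r : rainbow3 (letter s a p) (letter s a q) (letter s a r) = rainbow p q r.
  rewrite /rainbow3 /rainbow !eqnE !(inj_eq (@letter_inj s a)).
  by case: (p == q) => //=; case: (p == r).
by rewrite /= !codeE /= !rE addbF !addbA.
Qed.

End CodeWords.

Lemma all_solvable (E : {set clause}) : solvable_set E.
Proof.
have [/solvable_structured//|ns] := boolp.EM (structured E).
have ua l : uses_all E l.
  by have [//|[t h]] := uses_allPn E l; case: ns; apply: Or31; exists l, t.
have nd i l : i != l -> ~ determines E i l.
  by move=> il d; case: ns; apply: Or32; exists i, l.
have nb i j k : uniq [:: i; j; k] -> forall r, ~ shared_bit E i j k r.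
  by move=> u3 r [_ sb]; case: ns; apply: Or33; exists i, j, k, r.
have [e0 e0E _] := ua ord0 ord0.
(* Relabelling sends every question of [e0] to 0, which makes [e0] the fixed clause of the
   search. *)
pose s a := tperm (tnth e0 a) ord0.
have c0 : code s e0 = origin by rewrite codeE /letter /s !tpermL.
have [odd_triple|even_triples] := boolp.EM (exists f g, [/\ f \in E, g \in E &
    odd_rainbow (code s e0) (code s f) (code s g)]).
  have [f [g [fE gE]]] := odd_triple; rewrite rainbow_code.
  exact: solvable_rainbow.
have [||S XS] := @search_sound _ _ _ _ [pred c | [exists e in E, code s e == c]] search_codes.
- by move=> _ /exists_inP[e _ /eqP <-]; apply: code_codes.
- move=> _ _ /exists_inP[f fE /eqP <-] /exists_inP[g gE /eqP <-].
  by apply/negP => h; apply: even_triples; exists f, g; rewrite c0.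
apply: (@solvable_tame E s) => e eE; apply: XS.
by apply/exists_inP; exists e.
Qed.

(** * Reduction modulo two and the equality of the two spaces *)

Lemma odd_F2 (n : nat) (z : int) : odd n = odd `|z|%N -> n%:R = z%:~R :> 'F_2.
Proof.
have F2odd (m : nat) : m%:R = (odd m)%:R :> 'F_2.
  rewrite -{1}(odd_double_half m) natrD -mul2n natrM.
  have -> : 2%:R = 0 :> 'F_2 by apply: val_inj.
  by rewrite mul0r addr0.
move=> nz; rewrite F2odd nz -F2odd; case: z {nz} => m //.
rewrite NegzE mulrNz [LHS]/=.
have F2opp (x : 'F_2) : - x = x by case: x => [[|[|]]] // i; apply: val_inj.
by rewrite F2opp.
Qed.

Lemma sum_incidence (E : {set clause}) (y : 'cV[int]_#|E|) (z : clause -> int) k :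
  (forall i, z (enum_val i) = y i 0) -> (forall e, e \notin E -> z e = 0) ->
  ((incidence E)^T *m y) k 0 =
  \sum_(e : clause | tnth e (enum_val k).1 == (enum_val k).2) z e.
Proof.
move=> zy zE; rewrite mxE.
transitivity (\sum_(e in E | tnth e (enum_val k).1 == (enum_val k).2) z e).
  rewrite big_mkcondr /= [RHS]big_enum_val; apply: eq_bigr => i _.
  by rewrite !mxE -zy; case: eqP => _; rewrite ?mul1r ?mul0r.
rewrite [RHS](bigID (mem E)) /= [X in _ = _ + X]big1 ?addr0.
  by apply: eq_bigl => e; rewrite andbC.
by move=> e /andP[_ /zE].
Qed.

Lemma parity_kernel (E : {set clause}) (y : 'cV[int]_#|E|) : K_ E y ->
  exists w, [/\ clause_word E w, balanced w &
    parity E w = map_mx (fun z : int => z%:~R) y].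
Proof.
(* [z] extends [y] by zero to all clauses. *)
move=> Ky; pose z e := \sum_(i : 'I_#|E| | enum_val i == e) y i 0.
have zy i : z (enum_val i) = y i 0.
  rewrite /z (bigD1 i) //= big1 ?addr0 // => j /andP[/eqP/enum_val_inj ->].
  by rewrite eqxx.
have zE e : e \notin E -> z e = 0.
  by move=> nE; apply: big1 => i /eqP ie; rewrite -ie enum_valP in nE.
have zK a q : \sum_(e : clause | tnth e a == q) z e = 0.
  have := sum_incidence (enum_rank (a, q)) zy zE; rewrite enum_rankK /= => <-.
  by have -> : (incidence E)^T *m y = 0 := Ky; rewrite mxE.
(* Every clause asks player [ord0] exactly one question, so the kernel equations of this player add
   up to the total. *)
have zsum : \sum_e z e = 0.
  by rewrite (partition_big (fun e : clause => tnth e ord0) predT) //= big1.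
have [u [uE ou uz]] : exists u,
    [/\ {subset u <= E}, ~~ odd (size u) & forall e, scount e u = z e].
  have [[e0 e0E]|none] := boolp.EM (exists e, e \in E).
    exact: (scount_word (A := mem E) e0E).
  by exists [::]; split=> // e; rewrite zE //; apply/negP => eE; apply: none; exists e.
have [|v [vE vb vc]] := @all_solvable E u.
  by split=> // a q; rewrite scount_proj -[RHS](zK a q); apply: eq_bigr.
exists v; split=> //; apply/matrixP => i j; rewrite !mxE (ord1 j).
by apply: odd_F2; rewrite vc -scount_odd uz zy.
Qed.

Lemma kernel_parity (E : {set clause}) (w : seq clause) :
  clause_word E w -> balanced w -> L_ E (parity E w).
Proof.
move=> wE wb; exists (\col_i scount (enum_val i) w).
  apply/matrixP => k j; rewrite (ord1 j) [RHS]mxE.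
  rewrite (sum_incidence (z := fun e : clause => scount e w)).
  - rewrite -scount_proj; exact/scount_cancels/wb.
  - by move=> i; rewrite mxE.
  by move=> e nE; apply: scount_notin; apply: contra nE => /wE.
apply/matrixP => i j; rewrite !mxE; apply/esym/odd_F2.
by rewrite scount_odd.
Qed.

Theorem corollary3p2 (E : {set clause}) : L_ E = R_ E.
Proof.
apply/seteqP; split=> [_ [y /parity_kernel[w [wE wb wy]] <-]|v [s]].
  exists [:: parity E w]; last by rewrite -wy memv_span // mem_head.
  by move=> _ /[!inE] /eqP ->; exists w.
(* Generators of [R_E] lie in [L_E], which is closed under linear combinations; induction on the
   spanning list. *)
elim: s v => [|x s IH] v sX.
  rewrite span_nil memv0 => /eqP ->; exists 0; first by rewrite /K_ /= mulmx0.
  by apply/matrixP => i j; rewrite !mxE.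
rewrite span_cons => /memv_addP[_ /vlineP[c ->] [v' /IH hv ->]].
have [|y' Ky' <-] := hv.
  by move=> u us; apply: sX; rewrite inE us orbT.
have [w [wE wb] <-] := sX x (mem_head _ _).
have [y Ky <-] := kernel_parity wE wb.
(* The scalar [c] of ['F_2] is lifted to the integer 0 or 1. *)
exists ((val c)%:Z *: y + y').
  by rewrite /K_ /= mulmxDr -scalemxAr Ky Ky' scaler0 addr0.
apply/matrixP => i j; rewrite !mxE intrD intrM; congr (_ * _ + _).
by rewrite -[LHS]/((val c)%:R) natr_Zp.
Qed.
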